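(* Let $W\subset\mathbb{R}^d$ be measurable with $\lambda_d(W)=1$, let $t>e^2$, and let $\eta_t$ be a Poisson process on $\mathbb{R}^d$ with intensity measure $t\lambda_d$. Define $$ h_t(x,\mu)=\min_{y\in\mu\setminus\{x\}}tk_d\|x-y\|^d-\log(t),\qquad T_t=\max_{x\in\eta_t\cap W}h_t(x,\eta_t),\qquad \xi_t=\sum_{x\in\eta_t\cap W}\delta_{h_t(x,\eta_t)}, $$ and let $Y$ be a random variable with a standard Gumbel distribution, i.e. $\mathbb{P}(Y\le u)=e^{-e^{-u}}$ for $u\in\mathbb{R}$. Then $$ d_{TV}\big(\xi_t((u,\infty)),P_{e^{-u}}\big)\le2^d\frac{u+\log(t)}{e^{u/2}\sqrt t}+\frac{u+\log(t)}{e^ut}\qquad\text{for all }u>-\log(t), $$ and $$ d_K(T_t,Y)\le\big[2^{d+2}(4^d+2^d+2)+1\big]\frac{\log(t)}{\sqrt t}. $$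
   Context: $\lambda_d$ is Lebesgue measure on $\mathbb{R}^d$, $k_d$ is the volume of the $d$-dimensional unit ball, $\|\cdot\|$ is the Euclidean norm, $\delta_z$ is the Dirac measure at $z$. In $h_t(x,\mu)$, $x\in W$ and $\mu$ is a locally finite counting measure on $\mathbb{R}^d$ identified with its set of points. $P_\alpha$ is a Poisson random variable with mean $\alpha$. $d_{TV}(X,X')=\sup_{A\subset\mathbb{N}_0}|\mathbb{P}(X\in A)-\mathbb{P}(X'\in A)|$ for $\mathbb{N}_0$-valued random variables, and $d_K(T,Y)=\sup_{u\in\mathbb{R}}|\mathbb{P}(T>u)-\mathbb{P}(Y>u)|$. The maximum over the empty set is $-\infty$. *)

(* Defs.v *)
(* R^d is represented by d.-tuple R, whose product sigma-algebra is the Borel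
   sigma-algebra of R^d. *)
From HB Require Import structures.
From mathcomp Require Import all_boot all_order all_algebra.
From mathcomp Require Import all_classical all_reals all_analysis.
From mathcomp Require Import measurable_realfun.

Set Implicit Arguments.
Unset Strict Implicit.
Unset Printing Implicit Defensive.

Import Order.TTheory GRing.Theory Num.Theory.
Import numFieldNormedType.Exports.

Local Open Scope classical_set_scope.
Local Open Scope ring_scope.

Section lebesgue_measure_on_tuples.
Context {R : realType}.
Local Open Scope ereal_scope.

Definition tuple_cons d (p : R * d.-tuple R) : d.+1.-tuple R :=
  [tuple of p.1 :: p.2].

Lemma measurable_tuple_cons d : measurable_fun setT (@tuple_cons d).
Proof. exact: measurable_cons. Qed.

Section one_more_coordinate.
Variables (d : nat) (m : {sigma_finite_measure set (d.-tuple R) -> \bar R}).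

Definition lebesgue_cons : set (d.+1.-tuple R) -> \bar R :=
  pushforward (@lebesgue_measure R \x m) (@tuple_cons d).

Let lebesgue_cons0 : lebesgue_cons set0 = 0.
Proof. by rewrite /lebesgue_cons /pushforward preimage_set0 measure0. Qed.

Let lebesgue_cons_ge0 A : 0 <= lebesgue_cons A.
Proof. by rewrite /lebesgue_cons /pushforward; exact: integral_ge0. Qed.

Let mcons A : measurable A -> measurable (@tuple_cons d @^-1` A).
Proof.
by move=> mA; rewrite -[X in measurable X]setTI; exact: measurable_tuple_cons.
Qed.

Let lebesgue_cons_sigma_additive : semi_sigma_additive lebesgue_cons.
Proof.
move=> F mF tF mUF; rewrite /lebesgue_cons /pushforward preimage_bigcup.
apply: measure_semi_sigma_additive.
- by move=> n; exact: mcons.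
- apply/trivIsetP => /= i j _ _ ij; rewrite -preimage_setI.
  by move/trivIsetP : tF => /(_ _ _ _ _ ij) ->//; rewrite preimage_set0.
- by rewrite -preimage_bigcup; exact: mcons.
Qed.

HB.instance Definition _ := isMeasure.Build _ _ _ lebesgue_cons
  lebesgue_cons0 lebesgue_cons_ge0 lebesgue_cons_sigma_additive.

Let lebesgue_cons_sigma_finite : sigma_finite setT lebesgue_cons.
Proof.
have /sigma_finiteP[F [TF ndF Foo]] := sigma_finiteT (@lebesgue_measure R).
have /sigma_finiteP[G [TG ndG Goo]] := sigma_finiteT m.
pose g (x : d.+1.-tuple R) : R * d.-tuple R := (thead x, [tuple of behead x]).
have gK : cancel (@tuple_cons d) g by case=> a x; congr pair; exact: val_inj.
have mg : measurable_fun setT g.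
  apply: measurable_fun_pair; first exact: (@measurable_tnth _ _ _ ord0).
  exact: measurable_behead.
exists (fun n => g @^-1` (F n `*` G n)).
  apply/esym/seteqP; split => // x _.
  have : setT (g x).1 by []. rewrite TF => -[i _ Fi].
  have : setT (g x).2 by []. rewrite TG => -[j _ Gj].
  exists (maxn i j) => //; split => /=.
  - by move: Fi; exact/subsetPset/ndF/leq_maxl.
  - by move: Gj; exact/subsetPset/ndG/leq_maxr.
move=> n; have [? ?] := Foo n; have [? ?] := Goo n; split.
  by rewrite -[X in measurable X]setTI; apply: mg => //; exact: measurableX.
rewrite /lebesgue_cons /pushforward -comp_preimage.
rewrite (_ : g \o _ = id) ?preimage_id; last by apply/funext => p /=; rewrite gK.
by rewrite product_measure1E// lte_mul_pinfty// ge0_fin_numE.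
Qed.

HB.instance Definition _ := Measure_isSigmaFinite.Build _ _ _ lebesgue_cons
  lebesgue_cons_sigma_finite.

End one_more_coordinate.

(* d-fold product of the one-dimensional Lebesgue measure; on R^0 it is the
   unit mass at the empty tuple. *)
Fixpoint lebesgue d : {sigma_finite_measure set (d.-tuple R) -> \bar R} :=
  match d with
  | 0 => [the {sigma_finite_measure set (0.-tuple R) -> \bar R} of
            @dirac _ _ [tuple] R]
  | d'.+1 => [the {sigma_finite_measure set (d'.+1.-tuple R) -> \bar R} of
                lebesgue_cons (lebesgue d')]
  end.

Lemma lebesgue_box d (A : 'I_d -> set R) : (forall i, measurable (A i)) ->
  lebesgue d [set x | forall i, A i (tnth x i)] =
  \prod_(i < d) (@lebesgue_measure R (A i)).
Proof.
elim: d A => [|d IH] A mA.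
  rewrite big_ord0 /= diracE.
  by rewrite (_ : [set x | _] = setT) ?in_setT//; apply/seteqP; split => // x _ [].
rewrite big_ord_recl /= /lebesgue_cons /pushforward.
rewrite (_ : _ @^-1` _ =
  A ord0 `*` [set x | forall i, A (lift ord0 i) (tnth x i)]); last first.
  apply/seteqP; split => -[a x] /=.
    move=> h; split; first exact: (h ord0).
    by move=> i; have := h (lift ord0 i); rewrite tnthS.
  case=> a0 ax i; case: (unliftP ord0 i) => [j ->|->//].
  by rewrite tnthS; exact: ax.
have mB : measurable [set x : d.-tuple R | forall i, A (lift ord0 i) (tnth x i)].
  rewrite (_ : [set x | _] =
    \bigcap_(i in [set: 'I_d]) ((fun x => tnth x i) @^-1` A (lift ord0 i))).
    apply: fin_bigcap_measurable => // i _.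
    by rewrite -[X in measurable X]setTI; exact: measurable_tnth.
  by apply/seteqP; split => x h i; [move=> _; exact: h|exact: h].
rewrite product_measure1E; [|exact: mA|exact: mB].
by congr mule; exact: (IH (fun i => A (lift ord0 i))).
Qed.

End lebesgue_measure_on_tuples.

Section euclidean_space.
Context {R : realType} {d : nat}.
Implicit Types (x y : d.-tuple R) (S : set (d.-tuple R)).

Definition enorm x : R := Num.sqrt (\sum_(i < d) tnth x i ^+ 2).

Definition edist x y : R := enorm [tuple tnth x i - tnth y i | i < d].

Definition locally_finite S : Prop :=
  forall r : R, finite_set (S `&` [set x | enorm x <= r]).

End euclidean_space.

Definition unit_ball_volume (R : realType) (d : nat) : R :=
  fine (lebesgue d [set x : d.-tuple R | enorm x <= 1]).

(* Counts of points take values in N u {+oo}, encoded in \bar R. *)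
Definition nat_values {R : realType} (A : set nat) : set (\bar R) :=
  [set n%:R%:E | n in A].

Definition mutually_independent dO (Om : measurableType dO) (R : realType)
    (P : probability Om R) (n : nat) (X : 'I_n -> Om -> \bar R) : Prop :=
  forall A : 'I_n -> set (\bar R), (forall i, measurable (A i)) ->
  P [set w | forall i, A i (X i w)] = (\prod_(i < n) P (X i @^-1` A i))%E.

Section poisson_process.
Context {R : realType} {d : nat} dO {Om : measurableType dO}.

Definition num_points (eta : Om -> set (d.-tuple R)) (B : set (d.-tuple R))
  (w : Om) : \bar R := counting (eta w `&` B).

(* A locally finite counting measure on R^d is identified with its set of
   points, so that a point process is a random locally finite set. *)
Record is_poisson_process (P : probability Om R)
    (Lambda : set (d.-tuple R) -> \bar R) (eta : Om -> set (d.-tuple R)) :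
    Prop := IsPoissonProcess {
  poisson_process_locally_finite : forall w, locally_finite (eta w) ;
  poisson_process_measurable : forall B, measurable B ->
    measurable_fun setT (num_points eta B) ;
  (* the last argument of poisson_prob before the event is a dummy *)
  poisson_process_law : forall B, measurable B -> (Lambda B < +oo)%E ->
    forall A : set nat, P (num_points eta B @^-1` nat_values A) =
                        poisson_prob (fine (Lambda B)) 0%N A ;
  poisson_process_law_infinite : forall B, measurable B ->
    Lambda B = +oo%E -> P (num_points eta B @^-1` [set +oo%E]) = 1%E ;
  poisson_process_independent : forall n (B : 'I_n -> set (d.-tuple R)),
    (forall i, measurable (B i)) -> trivIset setT B ->
    mutually_independent P (fun i => num_points eta (B i)) }.

End poisson_process.

Section nearest_neighbours.
Context {R : realType} {d : nat}.
Local Open Scope ereal_scope.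
Implicit Types (t : R) (x : d.-tuple R) (mu W : set (d.-tuple R)).

(* The minimum is attained when mu is locally finite and has a point other
   than x; it is +oo when there is no such point. *)
Definition nn_h t x mu : \bar R :=
  ereal_inf [set (t * unit_ball_volume R d * edist x y ^+ d)%:E
            | y in mu `\ x] - (ln t)%:E.

(* The supremum is a maximum when mu `&` W is finite and nonempty, and -oo
   when it is empty. *)
Definition T_max t W mu : \bar R := ereal_sup [set nn_h t x mu | x in mu `&` W].

Definition xi t W mu (B : set (\bar R)) : \bar R :=
  \esum_(x in mu `&` W) \d_(nn_h t x mu) B.

End nearest_neighbours.

Section distances.
Context {R : realType} d1 d2 {Om1 : measurableType d1} {Om2 : measurableType d2}.
Variables (P1 : probability Om1 R) (X1 : Om1 -> \bar R).
Variables (P2 : probability Om2 R) (X2 : Om2 -> \bar R).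
Local Open Scope ereal_scope.

Definition dTV : \bar R := ereal_sup (range (fun A : set nat =>
  `| P1 (X1 @^-1` nat_values A) - P2 (X2 @^-1` nat_values A) |)).

Definition dK : \bar R := ereal_sup (range (fun u : R =>
  `| P1 [set w | u%:E < X1 w] - P2 [set w | u%:E < X2 w] |)).

End distances.

Definition poisson_distributed dO (Om : measurableType dO) (R : realType)
    (P : probability Om R) (alpha : R) (Z : {RV P >-> nat}) : Prop :=
  forall A : set nat, distribution P Z A = poisson_prob alpha 0%N A.

Definition standard_gumbel dO (Om : measurableType dO) (R : realType)
    (P : probability Om R) (Y : {RV P >-> R}) : Prop :=
  forall u : R, cdf Y u = (expR (- expR (- u)))%:E.

(* Main.v *)
(* A point x of eta in W has h(x) > u iff it is r-isolated: eta has no other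
   point within distance r of x, where r is such that a ball of radius r has
   mass v = u + log t. So the theorem compares the number of isolated points
   with a Poisson variable of mean t exp(-v) = exp(-u).

   Cut space into cells of small diameter. Which cells are occupied is decided
   by independent coin flips, and the number of isolated occupied cells is
   close to Poisson by the Chen-Stein method: conditionally on a cell k being
   isolated, the other isolated cells are those of the configuration in which
   the neighbours of k have been emptied. Emptying them changes the count by
   at most the number of cells that are isolated near k before or after, whose
   mean tends to v exp(-v) + 2^d v exp(-v/2) as the mesh is refined. The
   exponent v/2 comes from the fact that a ball centred outside another ball of
   the same radius has at least half of its volume outside that ball. Letting
   the mesh go to 0, and bounded windows grow to W, gives the bound on d_TV.

   The same bound at u >= 0 controls d_K. For u < 0 the factor exp(-u/2) is too
   large, but the Stein solution of the indicator of 0 decreases like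
   1/(lam n), and its value is independent of the disturbance around k when
   evaluated far from k, which gains a factor of order 1/lam. Below
   u = -log((log t)/2) both distribution functions are already small, by
   monotonicity. *)
Require Import Defs.
From HB Require Import structures.
From mathcomp Require Import all_boot all_order all_algebra.
From mathcomp Require Import all_classical all_reals all_analysis.
From mathcomp Require Import measurable_realfun.
From mathcomp Require Import ring lra.

Set Implicit Arguments.
Unset Strict Implicit.
Unset Printing Implicit Defensive.

Import Order.TTheory GRing.Theory Num.Theory.
Import numFieldNormedType.Exports.

Local Open Scope ring_scope.

(** * Independent coin flips and the size-bias coupling *)

(** The discretisation stands in for Palm calculus: for finitely many coin flips, conditioning on an
    isolated cell is a factorisation of a product weight, and every mean is a finite sum. For a
    fixed configuration the cell count equals the point count once the mesh is finer than finitely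
    many gaps, so only probabilities need a limit.

    The Stein equation is solved for the fixed parameter lam = exp(-u), while the true mean lam' of
    the discrete count depends on mesh and window. The mismatch lam - lam' meets a bound on the
    solution as crude as exp(lam)/lam, which is harmless because lam - lam' vanishes in the limit.

    For u < 0 the gain of 1/lam requires the mean of 1/(1 + count); it is obtained by feeding the
    test function n -> 1/(n + 1) into the first bound. The cut u = -log((log t)/2) is where
    exp(-lam) = 1/sqrt t. With a = 2^d the constant of the theorem is 4a^3 + 4a^2 + 8a + 1; the
    range between the cut and 0 costs 2a^3 + 4a^2 + 5a + 3, and the range below the cut 1/2 more. *)

Section random_subset.
Context {R : realFieldType} {K : finType}.
Variable q : K -> R.
Hypothesis q01 : forall k, 0 <= q k <= 1.
Implicit Types (s A B : {set K}) (F G : {set K} -> R).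

Definition weight s : R := \prod_k (if k \in s then q k else 1 - q k).
Definition mean F : R := \sum_s weight s * F s.

Lemma weight_ge0 s : 0 <= weight s.
Proof.
apply: prodr_ge0 => k _; have /andP[? ?] := q01 k.
by case: ifP; rewrite ?subr_ge0.
Qed.

Lemma mean_prod (phi : K -> bool -> R) :
  mean (fun s => \prod_k phi k (k \in s)) =
  \prod_k (q k * phi k true + (1 - q k) * phi k false).
Proof.
rewrite (@bigA_distr R 0 1 *%R +%R); apply: eq_bigr => s _.
rewrite /weight -big_split/=; by apply: eq_bigr => k _; case: (k \in s).
Qed.

Lemma weight_total : \sum_s weight s = 1.
Proof.
rewrite (_ : \sum_s _ = mean (fun s => \prod_k (fun _ _ => 1) k (k \in s))).
  by rewrite (mean_prod (fun _ _ => 1)) big1// => k _; rewrite !mulr1 addrC subrK.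
by apply: eq_bigr => s _; rewrite big1_eq mulr1.
Qed.

Lemma eq_mean F G : F =1 G -> mean F = mean G.
Proof. by move=> FG; apply: eq_bigr => s _; rewrite FG. Qed.

Lemma ler_mean F G : (forall s, F s <= G s) -> mean F <= mean G.
Proof. by move=> FG; apply: ler_sum => s _; rewrite ler_wpM2l ?weight_ge0. Qed.

Lemma mean_cst c : mean (fun=> c) = c.
Proof. by rewrite /mean -mulr_suml weight_total mul1r. Qed.

Lemma meanD F G : mean (fun s => F s + G s) = mean F + mean G.
Proof. by rewrite /mean -big_split; apply: eq_bigr => s _; rewrite mulrDr. Qed.

Lemma meanZ c F : mean (fun s => c * F s) = c * mean F.
Proof. by rewrite /mean mulr_sumr; apply: eq_bigr => s _; rewrite mulrCA. Qed.

Lemma meanB F G : mean (fun s => F s - G s) = mean F - mean G.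
Proof. by rewrite /mean -sumrB; apply: eq_bigr => s _; rewrite mulrBr. Qed.

Lemma mean_sum (I : finType) (P : pred I) (F : I -> {set K} -> R) :
  mean (fun s => \sum_(i | P i) F i s) = \sum_(i | P i) mean (F i).
Proof.
rewrite /mean exchange_big/=; apply: eq_bigr => s _; by rewrite mulr_sumr.
Qed.

Lemma ler_norm_mean F : `|mean F| <= mean (fun s => `|F s|).
Proof.
apply: le_trans (ler_norm_sum _ _ _) _; apply: ler_sum => s _.
by rewrite normrM (ger0_norm (weight_ge0 s)).
Qed.

Lemma mean_ge0 F : (forall s, 0 <= F s) -> 0 <= mean F.
Proof. by move=> F0; apply: sumr_ge0 => s _; rewrite mulr_ge0 ?weight_ge0. Qed.

(* Exchanging the parts outside A of two independent copies of the random set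
   preserves their joint law. *)
Lemma mean_indep A F G :
  (forall s, F (s :&: A) = F s) -> (forall s, G (s :\: A) = G s) ->
  mean (fun s => F s * G s) = mean F * mean G.
Proof.
move=> FA GA.
pose mix (p : {set K} * {set K}) := (p.1 :&: A) :|: (p.2 :\: A).
pose swap p := (mix p, mix (p.2, p.1)).
have swapK : involutive swap.
  move=> [s s']; congr pair; apply/setP => k; rewrite !inE/=;
    by case: (k \in A); rewrite /= ?(andbT, andbF, orbF).
have E2 (H : {set K} * {set K} -> R) :
    \sum_p weight p.1 * weight p.2 * H p = \sum_p weight p.1 * weight p.2 * H (swap p).
  rewrite (reindex_inj (inv_inj swapK)); apply: eq_bigr => -[s s'] _; congr (_ * _).
  rewrite /weight -!big_split; apply: eq_bigr => k _ /=; rewrite !inE/=.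
  case: (k \in A); rewrite /= ?(andbT, andbF, orbF)//; exact: mulrC.
transitivity (\sum_p weight p.1 * weight p.2 * (F p.1 * G p.1)).
  rewrite -(pair_big xpredT xpredT (fun s s' => weight s * weight s' * (F s * G s)))/=.
  apply: eq_bigr => s _; rewrite -mulr_suml -mulr_sumr weight_total mulr1//.
transitivity (\sum_p weight p.1 * weight p.2 * (F p.1 * G p.2)).
  rewrite [RHS]E2; apply: eq_bigr => -[s s'] _; congr (_ * (_ * _)) => /=.
    rewrite -[in RHS]FA; rewrite -FA; congr F; apply/setP => k; rewrite !inE.
    by case: (k \in A); rewrite /= ?(andbT, andbF, orbF).
  rewrite -[in RHS]GA; rewrite -GA; congr G; apply/setP => k; rewrite !inE.
  by case: (k \in A); rewrite /= ?(andbT, andbF, orbF).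
rewrite -(pair_big xpredT xpredT (fun s s' => weight s * weight s' * (F s * G s')))/=.
rewrite /mean mulr_suml; apply: eq_bigr => s _; rewrite mulr_sumr.
by apply: eq_bigr => s' _; ring.
Qed.

End random_subset.

(** * Isolated cells and the effect of emptying a neighbourhood *)

Section isolated_cells.
Context {K : finType}.
Variables (nb : rel K) (Kw : {set K}).
Hypotheses (nb_refl : reflexive nb) (nb_sym : symmetric nb).
Implicit Types (s A B : {set K}) (k j l : K).

Definition iso s k := (k \in s) && [forall l, (l != k) && nb k l ==> (l \notin s)].
Definition Iso s := [set k in Kw | iso s k].
(** The four radii have different tasks: [near1 k] decides whether k is isolated; emptying it can
    change isolation only inside [near2 k]; the flips in [near3 k] therefore determine the
    disturbance; and isolation of a cell outside [near4 k] does not look at [near3 k]. *)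
Definition near1 k := [set l | nb k l].
Definition grow A := [set j | [exists l in A, nb l j]].
Definition near2 k := grow (near1 k).
Definition near3 k := grow (near2 k).
Definition near4 k := grow (near3 k).

Lemma isoP s k : reflect (k \in s /\ forall l, l != k -> nb k l -> l \notin s) (iso s k).
Proof.
apply: (iffP andP) => -[ks h]; split=> //.
  by move=> l lk kl; have /forallP/(_ l)/implyP := h; apply; rewrite lk.
by apply/forallP => l; apply/implyP => /andP[]; exact: h.
Qed.

Lemma growP A j : reflect (exists2 l, l \in A & nb l j) (j \in grow A).
Proof.
rewrite inE; apply: (iffP existsP) => -[l].
  by case/andP => lA lj; exists l.
by move=> lA lj; exists l; rewrite lA.
Qed.

Lemma sub_grow A : A \subset grow A.
Proof. by apply/fintype.subsetP => k kA; apply/growP; exists k. Qed.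

Lemma near1_grow A k : k \in A -> near1 k \subset grow A.
Proof. by move=> kA; apply/fintype.subsetP => l; rewrite inE => kl; apply/growP; exists k. Qed.

Lemma near1_disjoint A k j : k \notin grow A -> j \in A -> j \notin near1 k.
Proof.
by move=> kA jA; apply: contra kA; rewrite inE nb_sym => jk; apply/growP; exists j.
Qed.

Lemma eq_iso s s' k : (forall l, nb k l -> (l \in s) = (l \in s')) -> iso s k = iso s' k.
Proof.
move=> ss'; apply/isoP/isoP => -[ks h]; split.
- by rewrite -ss'.
- by move=> l lk kl; rewrite -ss'//; exact: h.
- by rewrite ss'.
- by move=> l lk kl; rewrite ss'//; exact: h.
Qed.

Lemma iso_setI A s k : near1 k \subset A -> iso (s :&: A) k = iso s k.
Proof.
move=> /fintype.subsetP kA; apply: eq_iso => l kl; rewrite inE kA ?andbT// inE//.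
Qed.

Lemma iso_setD B s k : (forall l, nb k l -> l \notin B) -> iso (s :\: B) k = iso s k.
Proof. by move=> kB; apply: eq_iso => l kl; rewrite inE kB. Qed.

(** An isolated k is the only occupied cell of [near1 k], so emptying [near1 k] removes k alone. No
    other isolated cell neighbours k, and a cell outside [near1 k] does not have k as a neighbour,
    so removing k makes no cell isolated. *)
Lemma Iso_near1 s k : k \in Iso s -> Iso s = k |: Iso (s :\: near1 k).
Proof.
rewrite inE => /andP[kW /isoP[ks kiso]]; apply/setP => j; rewrite !inE.
have [->|jk] := eqVneq j k; first by rewrite kW; apply/isoP.
congr andb; apply/isoP/isoP => -[].
  move=> js jiso; split; last by move=> l lj jl; rewrite inE (negbTE (jiso _ lj jl)) andbF.
  rewrite !inE js andbT; apply/negP => kj.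
  by have := jiso k; rewrite eq_sym nb_sym ks => /(_ jk kj).
rewrite !inE => /andP[kj js] jiso; split=> // l lj jl.
have := jiso l lj jl; rewrite !inE negb_and negbK => /orP[kl|//].
by apply: kiso => //; apply: contraNneq kj => <-; rewrite nb_sym.
Qed.

Lemma card_Iso_near1 s k : k \in Iso s -> #|Iso s| = #|Iso (s :\: near1 k)|.+1.
Proof.
move=> /Iso_near1 ->; rewrite cardsU1 !inE /iso !inE nb_refl.
by rewrite andbF.
Qed.

(** The first summand bounds the loss and the second the gain of isolated cells when [near1 k] is
    emptied: a newly isolated cell had an occupied neighbour in [near1 k], hence lies in
    [near2 k]. *)
Definition disturb s k : nat :=
  #|Iso s :&: near1 k| + #|Iso (s :\: near1 k) :&: (near2 k :\: near1 k)|.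

Lemma IsoD_sub s k : Iso s :\: near1 k \subset Iso (s :\: near1 k).
Proof.
apply/fintype.subsetP => j; rewrite !inE => /andP[kj /andP[-> /isoP[js jiso]]] /=.
apply/isoP; split; first by rewrite !inE kj.
by move=> l lj jl; rewrite inE (negbTE (jiso l lj jl)) andbF.
Qed.

Lemma card_Iso_le s k : (#|Iso s| <= #|Iso (s :\: near1 k)| + disturb s k)%N.
Proof.
rewrite -(cardsID (near1 k) (Iso s)) /disturb addnC.
by apply: leq_add; [exact: subset_leq_card (IsoD_sub s k)|exact: leq_addr].
Qed.

Lemma card_IsoD_le s k : (#|Iso (s :\: near1 k)| <= #|Iso s| + disturb s k)%N.
Proof.
rewrite -(cardsID (near2 k :\: near1 k) (Iso (s :\: near1 k))) /disturb addnA.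
rewrite addnC leq_add2r; apply: leq_trans (leq_addr _ _).
apply: subset_leq_card; apply/fintype.subsetP => j; rewrite !inE negb_and negbK.
case/andP => h /andP[-> /isoP[]]; rewrite !inE => /andP[kj js] jiso /=.
apply/isoP; split=> // l lj jl; have := jiso l lj jl.
rewrite !inE negb_and negbK => /orP[kl|//].
move: h; rewrite (negbTE kj)/= => /existsP[]; exists l.
by rewrite inE kl nb_sym.
Qed.

(** The isolated cells far from k are thus counted both before and after emptying, and their number
    is a common lower bound at which a decreasing function can be evaluated. *)
Lemma Iso_far_sub s k : Iso s :\: near4 k \subset Iso (s :\: near1 k).
Proof.
apply: fintype.subset_trans (IsoD_sub s k); apply: finset.setDS.
do 3 (apply: fintype.subset_trans _ (sub_grow _)) => //; exact: subxx.
Qed.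

Lemma disturb_local s k : disturb (s :&: near3 k) k = disturb s k.
Proof.
have nA j : j \in near2 k -> near1 j \subset near3 k by exact: near1_grow.
congr (_ + _)%N; apply: eq_card => j.
  rewrite !inE; case kj : (nb k j); rewrite ?andbF// iso_setI//.
  by apply: nA; apply: (fintype.subsetP (sub_grow _)); rewrite inE.
rewrite !(inE, finset.in_setI, finset.in_setD); case j2 : (j \in near2 k); last first.
  by move: j2; rewrite inE => ->; rewrite !andbF.
have -> : (s :&: near3 k) :\: near1 k = (s :\: near1 k) :&: near3 k.
  by apply/setP => l; rewrite !inE andbA.
by rewrite iso_setI// nA.
Qed.

Lemma Iso_far_local s k : Iso (s :\: near3 k) :\: near4 k = Iso s :\: near4 k.
Proof.
apply/setP => j; rewrite !finset.in_setD !inE.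
case j4 : (j \in near4 k); move: (j4); rewrite inE => -> //=.
rewrite iso_setD// => l jl; apply/negP => l3.
by move/negbT: j4 => /near1_disjoint/(_ l3); rewrite inE jl.
Qed.

End isolated_cells.

(** * Chen-Stein bounds for the number of isolated cells *)

Section stein_size_bias.
Context {R : realFieldType} {K : finType}.
Variables (q : K -> R) (nb : rel K) (Kw : {set K}).
Hypotheses (q01 : forall k, 0 <= q k <= 1).
Hypotheses (nb_refl : reflexive nb) (nb_sym : symmetric nb).
Implicit Types (s A B : {set K}) (k j l : K).

Local Notation E := (mean q).
Local Notation Iso := (Iso nb Kw).
Local Notation iso := (iso nb).

Definition piso k := E (fun s => (iso s k)%:R).

Lemma natr_card A : #|A|%:R = \sum_(k in A) 1 :> R.
Proof. by rewrite sumr_const. Qed.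

Lemma natr_card_Iso s (A : {set K}) :
  #|Iso s :&: A|%:R = \sum_(k in Kw :&: A) (iso s k)%:R :> R.
Proof.
rewrite natr_card (big_mkcond (fun k => k \in Kw :&: A))/=.
rewrite big_mkcond/=; apply: eq_bigr => k _; rewrite !inE.
by case: (k \in Kw); case: (k \in A); case: (iso s k).
Qed.

Lemma mean_iso_setD B j : j \notin B ->
  E (fun s => (iso (s :\: B) j)%:R) =
  q j * \prod_(l in (near1 nb j :\: B) :\ j) (1 - q l).
Proof.
move=> jB.
(* The factor [phi l] is what isolation of j demands of cell l: j occupied, its other neighbours
   outside B vacant, nothing of the rest. The product over l is the indicator of isolation, and its
   mean factorises. *)
pose phi l (b : bool) : R := if l == j then b%:R else
  if l \in near1 nb j :\: B then (~~ b)%:R else 1.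
rewrite (@eq_mean _ _ _ _ (fun s => \prod_l phi l (l \in s))).
  rewrite (mean_prod q phi) (bigD1 j)//= /phi eqxx mulr1 mulr0 addr0; congr (_ * _).
  rewrite [LHS]big_mkcond [RHS]big_mkcond/=; apply: eq_bigr => l _; rewrite !inE.
  case: (eqVneq l j) => //= _; case: ifP => _; first by rewrite mulr0 mulr1 add0r.
  by rewrite !mulr1 addrC subrK.
move=> s; case: (boolP (iso _ _)) => [/isoP[]|].
  rewrite !inE => /andP[_ js] h; rewrite big1// => l _; rewrite /phi.
  case: eqVneq => [->|lj]; first by rewrite js.
  case: ifP => //; rewrite !inE => /andP[lB jl].
  by have := h l lj jl; rewrite !inE lB/= => ->.
move=> niso; apply/esym/eqP; apply/prodf_eq0.
case js : (j \in s); last by exists j => //; rewrite /phi eqxx js.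
have : ~~ [forall l, (l != j) && nb j l ==> (l \notin s :\: B)].
  by move: niso; rewrite negb_and !inE js jB.
case/forallPn => l; rewrite negb_imply negbK => /andP[/andP[lj jl]].
rewrite !inE => /andP[lB ls]; exists l => //.
by rewrite /phi (negbTE lj) !inE jl lB ls.
Qed.

Lemma pisoE j : piso j = q j * \prod_(l in near1 nb j :\ j) (1 - q l).
Proof.
have := @mean_iso_setD finset.set0 j; rewrite inE finset.setD0 => <-//.
by apply: eq_mean => s; rewrite finset.setD0.
Qed.

Lemma piso_ge0 j : 0 <= piso j.
Proof. by apply: mean_ge0 => // s; rewrite ler0n. Qed.

(* Whether k is isolated depends on the flips in near1 k only, hence is
   independent of the cells outside. *)
Lemma mean_Iso_size_bias (g : nat -> R) :
  E (fun s => #|Iso s|%:R * g #|Iso s|) =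
  \sum_(k in Kw) piso k * E (fun s => g #|Iso (s :\: near1 nb k)|.+1).
Proof.
rewrite (@eq_mean _ _ _ _ (fun s => \sum_(k in Kw)
    (iso s k)%:R * g #|Iso (s :\: near1 nb k)|.+1)).
  rewrite mean_sum; apply: eq_bigr => k kW.
  apply: (@mean_indep _ _ _ (near1 nb k)) => s; first by rewrite iso_setI.
  by rewrite finset.setDDl finset.setUid.
move=> s; rewrite -{1}[Iso s]finset.setIT natr_card_Iso finset.setIT mulr_suml.
apply: eq_bigr => k kW; case: (boolP (iso s k)) => [ks|]; last by rewrite !mul0r.
have kI : k \in Iso s by rewrite inE kW.
by rewrite !mul1r (card_Iso_near1 nb_refl nb_sym kI).
Qed.

Definition mean_disturb k := E (fun s => (disturb nb Kw s k)%:R).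

Lemma mean_disturbE k : mean_disturb k =
  \sum_(j in Kw :&: near1 nb k) piso j +
  \sum_(j in Kw :&: (near2 nb k :\: near1 nb k))
    q j * \prod_(l in (near1 nb j :\: near1 nb k) :\ j) (1 - q l).
Proof.
rewrite /mean_disturb; under eq_mean => s do rewrite /disturb natrD !natr_card_Iso.
rewrite meanD !mean_sum; congr (_ + _); apply: eq_bigr => j.
by rewrite !inE => /andP[_ /andP[kj _]]; rewrite mean_iso_setD// inE.
Qed.

Variables (lam e G : R) (g f : nat -> R) (c : R).
Hypotheses (lam_gt0 : 0 < lam).
Hypothesis disturb_le : forall k, k \in Kw -> mean_disturb k <= e.
Hypothesis gE : forall n, lam * g n.+1 - n%:R * g n = f n - c.
Hypothesis gG : forall n, `|g n.+1| <= G.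

Let lam' := \sum_(k in Kw) piso k.

(** Since [lam] need not be the mean [lam'] of the count, size-biasing leaves the first term as the
    price of the mismatch; the second compares the count with its coupled version, summed over the
    isolated cell. *)
Lemma stein_decomposition : E (fun s => f #|Iso s|) - c =
  (lam - lam') * E (fun s => g #|Iso s|.+1) +
  \sum_(k in Kw) piso k *
    E (fun s => g #|Iso s|.+1 - g #|Iso (s :\: near1 nb k)|.+1).
Proof.
rewrite -[c](mean_cst q) -meanB.
under eq_mean => s do rewrite -gE.
rewrite meanB meanZ mean_Iso_size_bias mulrBl -addrA; congr (_ + _).
rewrite /lam' mulr_suml -sumrN -sumrN -big_split; apply: eq_bigr => k _ /=.
by rewrite meanB; ring.
Qed.

Lemma stein_remainder (b : R) :
  (forall k, k \in Kw ->
    E (fun s => `|g #|Iso s|.+1 - g #|Iso (s :\: near1 nb k)|.+1|) <= b) ->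
  `|E (fun s => f #|Iso s|) - c| <= `|lam - lam'| * G + lam' * b.
Proof.
move=> hb; rewrite stein_decomposition.
apply: le_trans (ler_normD _ _) _; apply: lerD.
  rewrite normrM ler_wpM2l//; apply: le_trans (ler_norm_mean q01 _) _.
  by rewrite -[leRHS](mean_cst q); apply: ler_mean.
apply: le_trans (ler_norm_sum _ _ _) _; rewrite mulr_suml.
apply: ler_sum => k kW; rewrite normrM (ger0_norm (piso_ge0 k)).
rewrite ler_wpM2l ?piso_ge0//; apply: le_trans (ler_norm_mean q01 _) _; exact: hb.
Qed.

Lemma dist_card_Iso s k :
  `|#|Iso s|%:R - #|Iso (s :\: near1 nb k)|%:R| <= (disturb nb Kw s k)%:R :> R.
Proof.
have := card_Iso_le nb Kw s k; have := card_IsoD_le Kw nb_sym s k.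
rewrite -!(ler_nat R) !natrD ler_norml => h1 h2; apply/andP; split; lra.
Qed.

Lemma lipschitz_nat (h : nat -> R) (L : R) : (forall n, `|h n.+1 - h n| <= L) ->
  forall m n, `|h m - h n| <= L * `|m%:R - n%:R|.
Proof.
move=> hL; have L0 : 0 <= L by apply: le_trans (hL 0%N).
have step m n : `|h (n + m)%N - h n| <= L * m%:R.
  elim: m => [|m IH]; first by rewrite addn0 subrr normr0 mulr0.
  rewrite -(subrKA (h (n + m)%N)) addnS; apply: le_trans (ler_normD _ _) _.
  by rewrite -natr1 mulrDr mulr1 addrC; apply: lerD.
move=> m n; case: (leqP n m) => [nm|/ltnW nm].
  rewrite -{1}(subnKC nm); apply: le_trans (step _ _) _.
  by rewrite natrB// ler_wpM2l// ler_norm.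
rewrite distrC -{1}(subnKC nm); apply: le_trans (step _ _) _.
by rewrite natrB// ler_wpM2l// distrC ler_norm.
Qed.

Lemma stein_lipschitz_bound :
  (forall n, `|g n.+2 - g n.+1| <= lam^-1) ->
  `|E (fun s => f #|Iso s|) - c| <= `|lam - lam'| * G + lam' * (lam^-1 * e).
Proof.
move=> gL; apply: stein_remainder => k kW.
apply: (@le_trans _ _ (E (fun s => lam^-1 * (disturb nb Kw s k)%:R))).
  apply: ler_mean => // s.
  apply: le_trans (lipschitz_nat (h := fun n => g n.+1) gL _ _) _.
  by rewrite ler_wpM2l ?invr_ge0 ?(ltW lam_gt0)//; exact: dist_card_Iso.
by rewrite meanZ ler_wpM2l ?invr_ge0 ?(ltW lam_gt0)//; exact: disturb_le.
Qed.

(* The increment of g vanishes when the count is undisturbed and is otherwise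
   at most the value of g at the number of isolated cells far from k, which is
   independent of the disturbance. *)
Lemma stein_decreasing_bound (e4 : R) : 0 <= e ->
  (forall n, 0 <= g n.+1) -> (forall n, g n.+1 <= (lam * n.+1%:R)^-1) ->
  (forall m n, (m <= n)%N -> g n.+1 <= g m.+1) ->
  (forall k, k \in Kw -> \sum_(j in Kw :&: near4 nb k) piso j <= e4) ->
  `|E (fun s => f #|Iso s|) - c| <= `|lam - lam'| * G +
    lam' * (e * (lam^-1 * (E (fun s => #|Iso s|.+1%:R^-1) + e4))).
Proof.
move=> e_ge0 g0 gle gdec He4; apply: stein_remainder => k kW.
pose Z s := #|Iso s :\: near4 nb k|.
apply: (@le_trans _ _ (E (fun s => (disturb nb Kw s k)%:R * g (Z s).+1))).
  apply: ler_mean => // s.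
  have ZX : (Z s <= #|Iso s|)%N by apply: subset_leq_card; exact: finset.subsetDl.
  have ZY : (Z s <= #|Iso (s :\: near1 nb k)|)%N.
    by apply: subset_leq_card; exact: Iso_far_sub.
  case D0 : (disturb nb Kw s k) => [|n].
    have := dist_card_Iso s k; rewrite D0 normr_le0 subr_eq0 eqr_nat => /eqP->.
    by rewrite subrr normr0 mul0r.
  (* Both values of g lie between 0 and [g (Z s).+1] by monotonicity, so their distance does too;
     the disturbance is at least 1 here. *)
  apply: (@le_trans _ _ (g (Z s).+1)).
    by move: (g0 #|Iso s|) (g0 #|Iso (s :\: near1 nb k)|) (gdec _ _ ZX) (gdec _ _ ZY);
      rewrite ler_norml => *; apply/andP; split; lra.
  by rewrite ler_peMl// ler1n.
rewrite (@mean_indep _ _ _ (near3 nb k)); last first.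
- by move=> s; rewrite /Z Iso_far_local.
- by move=> s; rewrite disturb_local.
apply: ler_pM => //; [by apply: mean_ge0 => // s; rewrite ler0n|exact: mean_ge0|exact: disturb_le|].
(* This returns from Z to the full count: if no isolated cell lies in [near4 k], the two agree;
   otherwise 1/(Z + 1) <= 1, which is at most the number of isolated cells in [near4 k]. *)
apply: (@le_trans _ _ (E (fun s => lam^-1 *
   (#|Iso s|.+1%:R^-1 + #|Iso s :&: near4 nb k|%:R)))).
  apply: ler_mean => // s; apply: le_trans (gle _) _; rewrite invfM.
  rewrite ler_wpM2l ?invr_ge0 ?(ltW lam_gt0)//.
  rewrite -(cardsID (near4 nb k) (Iso s)) -/(Z s).
  case: #|_ :&: _| => [|n]; first by rewrite add0n addr0.
  apply: (@le_trans _ _ 1); first by rewrite invf_le1 ?ltr0n// ler1n.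
  by rewrite ler_wpDl ?invr_ge0 ?ler0n// ler1n.
rewrite meanZ ler_wpM2l ?invr_ge0 ?(ltW lam_gt0)// meanD lerD2l.
under eq_mean => s do rewrite natr_card_Iso.
by rewrite mean_sum; exact: He4.
Qed.

End stein_size_bias.

Local Open Scope classical_set_scope.
Local Open Scope ring_scope.

Local Notation edist := Defs.edist.

(** * Stein equation of the Poisson law *)

Section poisson_stein.
Context {R : realType}.
Variables (lam : R) (lam_gt0 : 0 < lam).
Implicit Types f : nat -> R.

(** The upper limit is strict: for f = 1 this is the probability of a value below n, so [1 - F n] is
    the tail from n on. *)
Definition poisson_partial f (n : nat) : R :=
  \sum_(0 <= j < n) poisson_pmf lam j * f j.
Definition poisson_mean f : R := limn (poisson_partial f).

Local Notation pi := (poisson_pmf lam).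
Local Notation F := (poisson_partial (fun=> 1)).
Local Notation S := poisson_partial.

Lemma poisson_pmf_gt0 k : 0 < pi k.
Proof.
by rewrite /poisson_pmf lam_gt0 !mulr_gt0// ?exprn_gt0 ?expR_gt0// invr_gt0 ltr0n fact_gt0.
Qed.

Lemma poisson_pmfS k : k.+1%:R * pi k.+1 = lam * pi k.
Proof.
rewrite /poisson_pmf lam_gt0 exprS factS natrM.
have k0 : (k`!%:R : R) != 0 by rewrite pnatr_eq0 -lt0n fact_gt0.
by field; rewrite k0 nat1r pnatr_eq0.
Qed.

Lemma poisson_pmfSE k : pi k.+1 = lam * pi k / k.+1%:R.
Proof. by rewrite -poisson_pmfS mulrAC divff ?mul1r// pnatr_eq0. Qed.

Lemma poisson_pmf0 : pi 0 = expR (- lam).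
Proof. by rewrite /poisson_pmf lam_gt0 expr0 fact0 invr1 !mul1r. Qed.

Lemma poisson_partialS f n : S f n.+1 = S f n + pi n * f n.
Proof. by rewrite /S big_nat_recr. Qed.

Lemma poisson_partial0 f : S f 0 = 0.
Proof. by rewrite /S big_geq. Qed.

Lemma poisson_partial_nd f : (forall k, 0 <= f k) -> nondecreasing_seq (S f).
Proof.
move=> f0; apply/nondecreasing_seqP => n.
by rewrite poisson_partialS lerDl mulr_ge0// poisson_pmf_ge0.
Qed.

Lemma cvg_poisson_total : F @ \oo --> (1 : R).
Proof.
have -> : F = (fun n => expR (- lam) * series (exp_coeff lam) n).
  apply/funext => n; rewrite /S /series/= mulr_sumr; apply: eq_bigr => i _.
  by rewrite mulr1 /poisson_pmf lam_gt0 /exp_coeff/= mulrC.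
rewrite (_ : 1 = expR (- lam) * expR lam); last by rewrite expRN mulVf// gt_eqF ?expR_gt0.
apply: cvgMr; exact: is_cvg_series_exp_coeff.
Qed.

Lemma poisson_total_le1 n : F n <= 1.
Proof.
have lF : limn F = 1 by apply: cvg_lim => //; exact: cvg_poisson_total.
rewrite -[leRHS]lF; apply: nondecreasing_cvgn_le; first exact: poisson_partial_nd.
by apply/cvg_ex; exists 1; exact: cvg_poisson_total.
Qed.

Lemma poisson_partial_le f n : (forall k, f k <= 1) -> S f n <= F n.
Proof.
by move=> f1; apply: ler_sum => k _; rewrite ler_wpM2l// poisson_pmf_ge0.
Qed.

Lemma poisson_partial_ge0 f n : (forall k, 0 <= f k) -> 0 <= S f n.
Proof. by move=> f0; apply: sumr_ge0 => k _; rewrite mulr_ge0// poisson_pmf_ge0. Qed.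

Lemma is_cvg_poisson_partial f : (forall k, 0 <= f k <= 1) -> cvgn (S f).
Proof.
move=> f01; apply: nondecreasing_is_cvgn.
  by apply: poisson_partial_nd => k; case/andP: (f01 k).
exists 1 => _ [n _ <-]; apply: le_trans (poisson_total_le1 n).
by apply: poisson_partial_le => k; case/andP: (f01 k).
Qed.

Lemma poisson_partial_le_mean f n : (forall k, 0 <= f k <= 1) ->
  S f n <= poisson_mean f.
Proof.
move=> f01; apply: nondecreasing_cvgn_le; last exact: is_cvg_poisson_partial.
by apply: poisson_partial_nd => k; case/andP: (f01 k).
Qed.

Lemma poisson_partial_compl f n : S (fun k => 1 - f k) n = F n - S f n.
Proof. by rewrite /S -sumrB; apply: eq_bigr => k _; rewrite mulr1 mulrBr mulr1. Qed.

Lemma poisson_mean_compl f : (forall k, 0 <= f k <= 1) ->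
  poisson_mean (fun k => 1 - f k) = 1 - poisson_mean f.
Proof.
move=> f01; apply/cvg_lim => //.
rewrite (_ : S _ = (fun n => F n - S f n)); last by apply/funext => n; exact: poisson_partial_compl.
by apply: cvgB; [exact: cvg_poisson_total|exact: is_cvg_poisson_partial].
Qed.

(** Termwise, (k + 1) pi_(n + 1) <= (n + 1) pi_(n + 1) = lam pi_n for n >= k. The inequality is
    summed over finite stretches of the tail and then passed to the limit. *)
Lemma poisson_tail_mul k : k.+1%:R * (1 - F k.+1) <= lam * (1 - F k).
Proof.
have h n : (k <= n)%N -> k.+1%:R * (F n.+1 - F k.+1) <= lam * (F n - F k).
  elim: n => [|n IH]; first by rewrite leqn0 => /eqP->; rewrite !subrr !mulr0.
  rewrite leq_eqVlt => /orP[/eqP->|]; first by rewrite !subrr !mulr0.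
  rewrite ltnS => kn; have := IH kn; rewrite (poisson_partialS _ n.+1) (poisson_partialS _ n) !mulr1.
  rewrite -/(S _ n) => {}IH.
  have : k.+1%:R * pi n.+1 <= lam * pi n.
    by rewrite -poisson_pmfS ler_wpM2r ?poisson_pmf_ge0// ler_nat ltnS.
  by move: IH; lra.
have c1 : (fun n => k.+1%:R * (F n.+1 - F k.+1)) @ \oo --> k.+1%:R * (1 - F k.+1).
  apply: cvgMr; apply: cvgB; last exact: cvg_cst.
  by rewrite (cvg_shiftS F); exact: cvg_poisson_total.
have c2 : (fun n => lam * (F n - F k)) @ \oo --> lam * (1 - F k).
  by apply: cvgMr; apply: cvgB; [exact: cvg_poisson_total|exact: cvg_cst].
apply: (ler_cvg_to c1 c2); near=> n; apply: h; near: n.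
by exists k.
Unshelve. all: by end_near. Qed.

(** The counterpart for the lower part: lam pi_j = (j + 1) pi_(j + 1) <= k pi_(j + 1) for j < k. *)
Lemma poisson_partial_mul k : lam * F k <= k%:R * F k.+1.
Proof.
elim: k => [|k IH]; first by rewrite poisson_partial0 mulr0 mul0r.
rewrite [in leLHS]poisson_partialS mulr1 mulrDr -poisson_pmfS.
rewrite (poisson_partialS _ k.+1) mulr1 mulrDr lerD2r.
by apply: le_trans IH _; rewrite ler_wpM2r ?ler_nat// poisson_partial_ge0// => *; lra.
Qed.

(** Up to a constant these ratios are the values of the Stein solution for the indicator of 0, so
    this is its monotonicity. Substituting pi_(k + 1) = lam pi_k / (k + 1) reduces it to a weakened
    [poisson_tail_mul]. *)
Lemma poisson_tail_ratio k : (1 - F k.+2) / pi k.+1 <= (1 - F k.+1) / pi k.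
Proof.
rewrite ler_pdivrMr ?poisson_pmf_gt0// -mulrA.
have -> : (pi k)^-1 * pi k.+1 = lam / k.+1%:R.
  by rewrite poisson_pmfSE; field; rewrite nat1r pnatr_eq0 (gt_eqF (poisson_pmf_gt0 _)).
rewrite mulrA ler_pdivlMr ?ltr0n// mulrC (mulrC _ lam).
apply: le_trans (poisson_tail_mul _).
by rewrite ler_wpM2r ?subr_ge0 ?poisson_total_le1// ler_nat.
Qed.

Lemma poisson_tail_ratio_le k : (1 - F k.+1) / pi k <= expR lam.
Proof.
elim: k => [|k IH]; last by apply: le_trans IH; exact: poisson_tail_ratio.
rewrite poisson_pmf0 expRN invrK ler_piMl ?expR_ge0// gerBl.
by rewrite poisson_partial_ge0.
Qed.

(** Multiplying the Stein equation by pi_k makes its left side telescope, which gives this quotient.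
    At k = 0 the numerator is an empty sum, so the value is 0 whatever the predecessor of 0 is taken
    to be. *)
Definition stein_sol f (k : nat) : R :=
  (S f k - poisson_mean f * F k) / (lam * pi k.-1).

Lemma stein_equation f k :
  lam * stein_sol f k.+1 - k%:R * stein_sol f k = f k - poisson_mean f.
Proof.
have pi0 := lt0r_neq0 (poisson_pmf_gt0 k).
have l0 := lt0r_neq0 lam_gt0.
rewrite /stein_sol/= !poisson_partialS mulr1.
case: k pi0 => [|k] pi0 /=.
  by rewrite !poisson_partial0 mul0r subr0; field; rewrite l0 pi0.
have h := poisson_pmfS k; rewrite -h.
by field; rewrite pi0 l0 nat1r pnatr_eq0.
Qed.

Lemma stein_sol_incr f k : (forall k, 0 <= f k <= 1) ->
  stein_sol f k.+2 - stein_sol f k.+1 <= lam^-1.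
Proof.
move=> f01; have p0 := poisson_pmf_gt0 k.+1.
rewrite /stein_sol/= -(poisson_pmfS k).
have k0 : (0 : R) < k.+1%:R by rewrite ltr0n.
have := poisson_partial_mul k.+1; have := poisson_tail_mul k.+1.
have := poisson_partial_le_mean k.+2 f01.
have : 0 <= S f k.+1 by apply: poisson_partial_ge0 => j; case/andP: (f01 j).
have : 0 <= 1 - F k.+2 by rewrite subr_ge0 poisson_total_le1.
rewrite !(poisson_partialS _ k.+1) mulr1.
move: p0 (f01 k.+1) (poisson_mean f) (S f k.+1) (F k.+1) k0 => + /andP[].
move: (pi k.+1) (f k.+1) (k.+1%:R : R) (k.+2%:R : R) (natr1 k.+1 : k.+1%:R + 1 = k.+2%:R :> R) => p x n n' <-.
move=> p0 x0 x1 c s F1 n0 T0 s0 sc h1 h2.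
rewrite -subr_ge0.
suff -> : lam^-1 - ((s + p * x - c * (F1 + p)) / (lam * p) - (s - c * F1) / (n * p)) =
  (n * p - ((s + p * x - c * (F1 + p)) * n - lam * (s - c * F1))) / (lam * n * p).
  rewrite divr_ge0 ?mulr_ge0 ?(ltW lam_gt0) ?(ltW n0) ?(ltW p0)//.
  (* The numerator is exactly the sum of the four nonnegative products e1 to e4; the two
     inequalities between neighbouring values of F and of its tail supply the signs. *)
  have e1 : 0 <= (c - (s + p * x)) * (n * (F1 + p) - lam * F1) by rewrite mulr_ge0; lra.
  have e2 : 0 <= s * (lam * (1 - F1) - n * (1 - (F1 + p))).
    by rewrite mulr_ge0//; nra.
  have e3 : 0 <= p * x * (n * (F1 + p) - lam * F1) by rewrite mulr_ge0 ?mulr_ge0//; lra.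
  have e4 : 0 <= p * n * (1 - x) by rewrite mulr_ge0 ?mulr_ge0; lra.
  nra.
by field; rewrite !gt_eqF.
Qed.

(** Passing to 1 - f turns the upper bound on increments into the lower one. *)
Lemma stein_sol_compl f k : (forall k, 0 <= f k <= 1) ->
  stein_sol (fun k => 1 - f k) k = - stein_sol f k.
Proof.
move=> f01; rewrite /stein_sol poisson_mean_compl// poisson_partial_compl.
by rewrite -[RHS]mulNr; congr (_ / _); ring.
Qed.

Lemma stein_sol_lipschitz f k : (forall k, 0 <= f k <= 1) ->
  `|stein_sol f k.+2 - stein_sol f k.+1| <= lam^-1.
Proof.
move=> f01; rewrite ler_norml stein_sol_incr// andbT.
have := @stein_sol_incr (fun k => 1 - f k) k.
rewrite !stein_sol_compl// opprK => /(_ _)/wrap[|]; last lra.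
by move=> j; have := f01 j; lra.
Qed.

(** A crude bound, exponential in lam, suffices: it only multiplies the difference of the means,
    which tends to 0. *)
Lemma stein_sol_bounded f k : (forall k, 0 <= f k <= 1) ->
  `|stein_sol f k.+1| <= expR lam / lam.
Proof.
move=> f01; rewrite /stein_sol/= normrM.
rewrite [X in _ * X]ger0_norm; last by rewrite invr_ge0 mulr_ge0 ?ltW// poisson_pmf_gt0.
rewrite invfM mulrA mulrAC ler_pM2r ?invr_gt0//.
apply: le_trans (poisson_tail_ratio_le k).
rewrite ler_pM2r ?invr_gt0 ?poisson_pmf_gt0//.
(* It remains to show |S f - c F| <= 1 - F. The mean c exceeds the partial sum S f by an amount
   between 0 and 1 - F, the upper end coming from 1 - f. *)
have := poisson_partial_le_mean k.+1 f01.
have f'01 j : 0 <= 1 - f j <= 1 by have := f01 j; lra.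
have := poisson_partial_le_mean k.+1 f'01.
rewrite poisson_mean_compl// poisson_partial_compl.
have : 0 <= S f k.+1 by apply: poisson_partial_ge0 => j; case/andP: (f01 j).
have : 0 <= F k.+1 by apply: poisson_partial_ge0.
have : S f k.+1 <= F k.+1 by apply: poisson_partial_le => j; case/andP: (f01 j).
have := poisson_total_le1 k.+1.
move: (S f _) (F _) (poisson_mean f) => s F1 c F1le sF F0 s0 cs sc.
have e1 : 0 <= (F1 - s) * (1 - F1) by rewrite mulr_ge0; lra.
have e2 : 0 <= F1 * (c - s) by rewrite mulr_ge0; lra.
have e3 : 0 <= s * (1 - F1) by rewrite mulr_ge0; lra.
have e4 : 0 <= F1 * ((1 - F1) - (c - s)) by rewrite mulr_ge0; lra.
have e5 : 0 <= (1 - F1) * (1 - F1) by rewrite mulr_ge0; lra.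
rewrite ler_norml; apply/andP; split; nra.
Qed.

Definition ind0 (k : nat) : R := (k == 0%N)%:R.

Lemma ind0_01 k : 0 <= ind0 k <= 1.
Proof. by rewrite /ind0; case: eqP => _ /=; lra. Qed.

Lemma poisson_partial_ind0 k : S ind0 k.+1 = expR (- lam).
Proof.
elim: k => [|k IH]; rewrite poisson_partialS /ind0 ?IH/= ?mulr0 ?addr0//.
by rewrite poisson_partial0 add0r mulr1 poisson_pmf0.
Qed.

Lemma poisson_mean_ind0 : poisson_mean ind0 = expR (- lam).
Proof.
apply/cvg_lim => //; rewrite -cvg_shiftS/=.
by under eq_fun do rewrite poisson_partial_ind0; exact: cvg_cst.
Qed.

Lemma stein_sol_ind0 k :
  stein_sol ind0 k.+1 = expR (- lam) / lam * ((1 - F k.+1) / pi k).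
Proof.
rewrite /stein_sol/= poisson_partial_ind0 poisson_mean_ind0.
by field; rewrite !gt_eqF// poisson_pmf_gt0.
Qed.

Lemma stein_sol_ind0_ge0 k : 0 <= stein_sol ind0 k.+1.
Proof.
rewrite stein_sol_ind0 mulr_ge0// divr_ge0 ?expR_ge0 ?(ltW lam_gt0)//.
  by rewrite subr_ge0 poisson_total_le1.
by rewrite poisson_pmf_ge0.
Qed.

Lemma stein_sol_ind0_decr k l : (k <= l)%N ->
  stein_sol ind0 l.+1 <= stein_sol ind0 k.+1.
Proof.
apply: (@homo_leq _ (fun k => stein_sol ind0 k.+1) (fun x y => y <= x)) => //.
  by move=> y x z yx zy; exact: le_trans zy yx.
move=> i; rewrite !stein_sol_ind0 ler_wpM2l ?poisson_tail_ratio//.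
by rewrite divr_ge0 ?expR_ge0 ?(ltW lam_gt0).
Qed.

(* By monotonicity of (j + 1) (1 - F_(j + 1)) / pi_j in j. *)
Lemma stein_sol_ind0_le k : stein_sol ind0 k.+1 <= (lam * k.+1%:R)^-1.
Proof.
have h j : j.+1%:R * ((1 - F j.+1) / pi j) <= expR lam.
  elim: j => [|j IH]; first by rewrite mul1r; exact: poisson_tail_ratio_le.
  apply: le_trans IH.
  rewrite mulrA ler_pdivrMr ?poisson_pmf_gt0//.
  rewrite (_ : _ * pi j.+1 = lam * (1 - F j.+1)); first exact: poisson_tail_mul.
  by rewrite poisson_pmfSE; field; rewrite nat1r pnatr_eq0 (gt_eqF (poisson_pmf_gt0 _)).
rewrite stein_sol_ind0 invfM -mulrA -ler_pdivlMl ?divr_gt0 ?expR_gt0//.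
rewrite expRN invrK -ler_pdivlMl ?invr_gt0// invrK.
rewrite (_ : lam * _ = expR lam / k.+1%:R).
  by rewrite ler_pdivlMr ?ltr0n// mulrC.
by field; rewrite nat1r pnatr_eq0 (gt_eqF lam_gt0).
Qed.

(* Summand by summand, lam pi_k / (k + 1) = pi_(k + 1). *)
Lemma poisson_mean_invS : poisson_mean (fun k => k.+1%:R^-1) <= lam^-1.
Proof.
have f01 k : 0 <= (k.+1%:R : R)^-1 <= 1.
  by rewrite invr_ge0 ler0n invf_le1 ?ltr0n// ler1n.
apply: limr_le; first exact: is_cvg_poisson_partial.
near=> n; apply: (@le_trans _ _ (lam^-1 * F n.+1)).
  rewrite /S [X in _ <= _ * X]big_nat_recl// mulrDr.
  apply: ler_wpDl.
    by rewrite mulr1 mulr_ge0 ?invr_ge0 ?poisson_pmf_ge0// ltW.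
  rewrite mulr_sumr; apply: ler_sum => i _; rewrite mulr1.
  rewrite -(ler_pM2l lam_gt0) mulrA -poisson_pmfS mulrA divff ?gt_eqF// mul1r.
  by rewrite mulrAC divff ?mul1r// pnatr_eq0.
by rewrite ler_piMr ?invr_ge0 ?poisson_total_le1// ltW.
Unshelve. all: by end_near. Qed.

Lemma poisson_mean_indic (A : set nat) :
  (poisson_mean (\1_A : nat -> R))%:E = poisson_prob lam 0 A.
Proof.
rewrite /poisson_prob lam_gt0 esum_mkcond -nneseries_esumT; last first.
  by move=> n; case: ifP => // _; rewrite lee_fin poisson_pmf_ge0.
rewrite /poisson_mean -EFin_lim; last first.
  by apply: is_cvg_poisson_partial => k; rewrite indicE; case: (_ \in _) => /=; lra.
apply/congr_lim/funext => n /=; rewrite -sumEFin.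
by apply: eq_bigr => i _; rewrite indicE; case: (_ \in _); rewrite ?mulr1 ?mulr0.
Qed.

End poisson_stein.

(** * Volumes of balls *)

Section euclidean_metric.
Context {R : realType} {d : nat}.
Implicit Types (x y z : d.-tuple R) (r : R).

Lemma cauchy_schwarz_sum (a b : 'I_d -> R) :
  (\sum_i a i * b i) ^+ 2 <= (\sum_i a i ^+ 2) * (\sum_i b i ^+ 2).
Proof.
set A := \sum_i a i ^+ 2; set B := \sum_i b i ^+ 2; set C := \sum_i a i * b i.
have B0 : 0 <= B by apply: sumr_ge0 => i _; exact: sqr_ge0.
(* B times the defect is the squared length of B a - C b. If B = 0, then b vanishes and there is
   nothing to divide by. *)
have : 0 <= B * (A * B - C ^+ 2).
  rewrite (_ : B * _ = \sum_i (B * a i - C * b i) ^+ 2).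
    by apply: sumr_ge0 => i _; exact: sqr_ge0.
  transitivity (\sum_i (B ^+ 2 * a i ^+ 2 - (B * C *+ 2) * (a i * b i) + C ^+ 2 * b i ^+ 2)).
    rewrite (_ : \sum_i _ = B ^+ 2 * A - (B * C *+ 2) * C + C ^+ 2 * B).
      by move: A B C {B0} => A B C; ring.
    by rewrite big_split/= sumrB /A {3}/C {4}/B !mulr_sumr.
  by apply: eq_bigr => i _; ring.
move: B0; rewrite le_eqVlt => /orP[/eqP B0 _|B0]; last by rewrite pmulr_rge0// subr_ge0.
have b0 i : b i = 0.
  apply/eqP; rewrite -sqrf_eq0; apply/eqP.
  have /psumr_eq0P : forall i, true -> 0 <= b i ^+ 2 by move=> j _; exact: sqr_ge0.
  by apply.
by rewrite /C big1 ?expr0n/= -?B0 ?mulr0// => i _; rewrite b0 mulr0.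
Qed.

Lemma edistE x y : edist x y = Num.sqrt (\sum_(i < d) (tnth x i - tnth y i) ^+ 2).
Proof. by rewrite /edist /enorm; congr Num.sqrt; apply: eq_bigr => i _; rewrite tnth_mktuple. Qed.

Lemma edist_nonneg x y : 0 <= edist x y.
Proof. exact: sqrtr_ge0. Qed.

Lemma edistC x y : edist x y = edist y x.
Proof. by rewrite !edistE; congr Num.sqrt; apply: eq_bigr => i _; rewrite -sqrrN opprB. Qed.

Lemma edistxx x : edist x x = 0.
Proof. by rewrite edistE big1 ?sqrtr0// => i _; rewrite subrr expr0n. Qed.

Lemma sqr_edist x y : edist x y ^+ 2 = \sum_(i < d) (tnth x i - tnth y i) ^+ 2.
Proof. by rewrite edistE sqr_sqrtr//; apply: sumr_ge0 => i _; exact: sqr_ge0. Qed.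

Lemma edist_eq0 x y : edist x y = 0 -> x = y.
Proof.
move=> xy; apply: eq_from_tnth => i; apply/eqP; rewrite -subr_eq0 -sqrf_eq0; apply/eqP.
have /psumr_eq0P : forall i, true -> 0 <= (tnth x i - tnth y i) ^+ 2.
  by move=> j _; exact: sqr_ge0.
by apply => //; rewrite -sqr_edist xy expr0n.
Qed.

Lemma ler_edistD y x z : edist x z <= edist x y + edist y z.
Proof.
rewrite -(@ler_pXn2r _ 2) ?nnegrE ?addr_ge0 ?edist_nonneg// sqrrD !sqr_edist.
pose a i := tnth x i - tnth y i; pose b i := tnth y i - tnth z i.
have -> : \sum_(i < d) (tnth x i - tnth z i) ^+ 2 =
    \sum_(i < d) a i ^+ 2 + (\sum_(i < d) a i * b i) *+ 2 + \sum_(i < d) b i ^+ 2.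
  rewrite -sumrMnl -!big_split; apply: eq_bigr => i _ /=; rewrite /a /b; ring.
rewrite lerD2r lerD2l lerMn2r/=; apply: le_trans (ler_norm _) _.
rewrite -(@ler_pXn2r _ 2) ?nnegrE ?mulr_ge0 ?edist_nonneg ?normr_ge0//.
by rewrite real_normK ?num_real// exprMn !sqr_edist; exact: cauchy_schwarz_sum.
Qed.

Lemma edist_coord x y i : `|tnth x i - tnth y i| <= edist x y.
Proof.
rewrite -(@ler_pXn2r _ 2) ?nnegrE ?edist_nonneg ?normr_ge0// sqr_edist.
rewrite real_normK ?num_real// (bigD1 i)//= lerDl; apply: sumr_ge0 => j _; exact: sqr_ge0.
Qed.

(** The factor d in place of sqrt d is good enough, as it only affects the side length of cells and
    of an inscribed cube. *)
Lemma edist_le_coord x y r : 0 <= r ->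
  (forall i, `|tnth x i - tnth y i| <= r) -> edist x y <= d%:R * r.
Proof.
move=> r0 h; rewrite -(@ler_pXn2r _ 2) ?nnegrE ?edist_nonneg ?mulr_ge0// sqr_edist.
apply: (@le_trans _ _ (\sum_(i < d) r ^+ 2)).
  apply: ler_sum => i _; rewrite -(real_normK (num_real (_ - _))).
  by rewrite ler_pXn2r ?nnegrE.
rewrite sumr_const card_ord -[leLHS]mulr_natl exprMn ler_wpM2r ?sqr_ge0//.
by rewrite -natrX ler_nat; case: (d) => // n; rewrite expnS expn1 leq_pmulr.
Qed.

Lemma enorm_edist x : enorm x = edist x [tuple 0 | _ < d].
Proof.
rewrite edistE /enorm; congr Num.sqrt; apply: eq_bigr => i _.
by rewrite tnth_mktuple subr0.
Qed.

Definition ball_at x r := [set y | edist x y <= r].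

Lemma measurable_edist x : measurable_fun [set: d.-tuple R] (edist x).
Proof.
rewrite (_ : edist x = (fun y => Num.sqrt (\sum_(i < d) (tnth x i - tnth y i) ^+ 2))); last first.
  by apply/funext => y; rewrite edistE.
apply: (@measurableT_comp _ _ _ _ _ _ (@Num.sqrt R)).
  by apply: continuous_measurable_fun; exact: sqrt_continuous.
apply: measurable_sum => i; apply: measurable_funX; apply: measurable_funB => //.
exact: measurable_tnth.
Qed.

Lemma measurable_ball_at x r : measurable (ball_at x r).
Proof.
rewrite (_ : ball_at x r = edist x @^-1` [set` `]-oo, r]]); last first.
  by apply/seteqP; split => y /=; rewrite in_itv.
rewrite -[X in measurable X]setTI; apply: measurable_edist => //.
Qed.

End euclidean_metric.

Section affine_maps.
Context {R : realType}.
Local Open Scope ereal_scope.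

Definition affine d (a : R) (b : d.-tuple R) (x : d.-tuple R) : d.-tuple R :=
  [tuple (a * tnth x i + tnth b i)%R | i < d].

(** By uniqueness of Lebesgue measure it is enough to test half-open intervals. Negative a, which
    swaps the open and the closed end, is included for the sake of point reflections. *)
Lemma lebesgue_measure_affine (a b : R) (A : set R) : a != 0%R -> measurable A ->
  lebesgue_measure ((fun x : R => (a * x + b)%R) @^-1` A) = (`|a|^-1)%:E * lebesgue_measure A.
Proof.
move=> a0 mA.
have na0 : (0 < `|a|)%R by rewrite normr_gt0.
pose f : measurableTypeR R -> measurableTypeR R := fun x : R => (a * x + b)%R.
have mf : measurable_fun setT f.
  by apply: measurable_funD => //; apply: measurable_funM.
pose mf_mixin := isMeasurableFun.Build _ _ _ _ _ mf.
pose F : {mfun _ >-> _} := HB.pack f mf_mixin.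
pose m : {measure set (measurableTypeR R) -> \bar R} :=
  mscale (NngNum (ltW na0)) (pushforward (@lebesgue_measure R) F).
suff -> : lebesgue_measure A = m mf A.
  by rewrite /m/= /mscale/= /pushforward muleA -EFinM mulVf ?mul1e// gt_eqF.
apply: lebesgue_measure_unique => // _ [[x y] _ <-] /=.
rewrite /m/= /mscale/= /pushforward/=.
have [a1|a1] := ltP 0%R a.
  rewrite (_ : F @^-1` _ = [set` `]((x - b) / a)%R, ((y - b) / a)%R]]); last first.
    apply/seteqP; split => z /=; rewrite /f !in_itv/= ltr_pdivrMr// ler_pdivlMr//;
      rewrite ltrBlDr lerBrDr (mulrC z); done.
  rewrite !lebesgue_measure_itv/= !lte_fin ltr_pM2r ?invr_gt0// ltrD2r.
  case: ifPn => _; last by rewrite mule0.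
  by rewrite -!EFinB -EFinM gtr0_norm//; congr EFin; field; rewrite gt_eqF.
have {}a1 : (a < 0)%R by rewrite lt_neqAle a0.
rewrite (_ : F @^-1` _ = [set` `[((y - b) / a)%R, ((x - b) / a)%R[]); last first.
  apply/seteqP; split => z /=; rewrite /f !in_itv/= ler_ndivrMr// ltr_ndivlMr//;
    rewrite ltrBlDr lerBrDr (mulrC z) andbC; done.
rewrite !lebesgue_measure_itv/= !lte_fin ltr_nM2r ?invr_lt0// ltrD2r.
case: ifPn => _; last by rewrite mule0.
by rewrite -!EFinB -EFinM ltr0_norm//; congr EFin; field; rewrite lt_eqF.
Qed.

Lemma ge0_integral_affine (a b : R) (f : R -> \bar R) : a != 0%R ->
  measurable_fun setT f -> (forall x, 0 <= f x) ->
  \int[lebesgue_measure]_x f (a * x + b)%R = (`|a|^-1)%:E * \int[lebesgue_measure]_x f x.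
Proof.
move=> a0 mf f0.
have na0 : (0 <= `|a|^-1)%R by rewrite invr_ge0.
pose g : measurableTypeR R -> measurableTypeR R := fun x : R => (a * x + b)%R.
have mg : measurable_fun setT g.
  by apply: measurable_funD => //; apply: measurable_funM.
transitivity (\int[pushforward (@lebesgue_measure R) g]_x f x).
  by rewrite (ge0_integral_pushforward mg) ?preimage_setT.
rewrite -(ge0_integral_mscale _ measurableT (NngNum na0))//.
apply: eq_measure_integral => A mA _.
exact: lebesgue_measure_affine.
Qed.

(** Induction over coordinates: the sections contribute d factors by the induction hypothesis, the
    substitution in the first coordinate one more. *)
Lemma lebesgue_affine d (a : R) (b : d.-tuple R) (A : set (d.-tuple R)) :
  a != 0%R -> measurable A ->
  lebesgue d (affine a b @^-1` A) = ((`|a| ^- d)%R)%:E * lebesgue d A.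
Proof.
move=> a0; elim: d b A => [|d IH] b A mA.
  rewrite expr0 invr1 mul1e /=; congr (dirac _ _).
  apply/seteqP; split => x /=; rewrite (tuple0 x) (tuple0 (affine _ _ _))//.
rewrite /= /lebesgue_cons /pushforward /product_measure1/=.
have mcA : measurable (@tuple_cons R d @^-1` A).
  by rewrite -[X in measurable X]setTI; exact: measurable_tuple_cons.
case: (tupleP b) => b0 {}b.
transitivity (\int[lebesgue_measure]_x ((`|a| ^- d)%:E *
    lebesgue d (xsection (@tuple_cons R d @^-1` A) (a * x + b0)%R))).
  apply: eq_integral => x _ /=; rewrite -(IH b); last exact: measurable_xsection.
  congr (lebesgue d _); apply/seteqP; split => y; rewrite /xsection/= !inE/=;
   rewrite (_ : affine _ _ _ = tuple_cons ((a * x + b0)%R, affine a b y))//;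
   apply: eq_from_tnth => i; rewrite tnth_mktuple; case: (unliftP ord0 i) => [j|] ->;
   by rewrite ?tnthS ?tnth0 ?tnth_mktuple.
rewrite ge0_integralZl//; last first.
- apply: (measurableT_comp (measurable_fun_xsection _ mcA)).
  by apply: measurable_funD => //; apply: measurable_funM.
rewrite (ge0_integral_affine b0 a0 (measurable_fun_xsection _ mcA)) => [|x]; last by [].
by rewrite muleA -EFinM exprSr invfM.
Qed.

End affine_maps.

Section ball_volume.
Context {R : realType} {d : nat} (d_gt0 : (0 < d)%N).
Local Notation k_ := (unit_ball_volume R d).
Implicit Types (x y : d.-tuple R) (r : R).

Let unit_ballE : [set x : d.-tuple R | enorm x <= 1] = ball_at [tuple 0 | _ < d] 1.
Proof. by apply/seteqP; split => x /=; rewrite enorm_edist edistC. Qed.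

Lemma lebesgue_cube (a b : R) : a <= b ->
  lebesgue d [set x : d.-tuple R | forall i, `[a, b]%classic (tnth x i)] = ((b - a) ^+ d)%:E.
Proof.
move=> ab; rewrite (@lebesgue_box _ _ (fun=> `[a, b]%classic))//.
under eq_bigr do rewrite lebesgue_measure_itv/= lte_fin.
rewrite (_ : (if (a < b)%R then _ else _) = (b - a)%:E).
  by rewrite prodEFin prodr_const card_ord.
by case: ltP => // ba; rewrite (@le_anti _ _ a b) ?ab// subrr.
Qed.

Lemma measurable_cube (A : set R) : measurable A ->
  measurable [set x : d.-tuple R | forall i, A (tnth x i)].
Proof.
move=> mA; rewrite (_ : [set x | _] =
    \bigcap_(i in [set: 'I_d]) ((fun x => tnth x i) @^-1` A)).
  apply: fin_bigcap_measurable => // i _.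
  by rewrite -[X in measurable X]setTI; exact: measurable_tnth.
by apply/seteqP; split => x h i; [move=> _; exact: h|exact: h].
Qed.

Lemma lebesgue_unit_ball : lebesgue d [set x : d.-tuple R | enorm x <= 1] = k_%:E.
Proof.
rewrite fineK// ge0_fin_numE//.
apply: (@le_lt_trans _ _ (lebesgue d [set x : d.-tuple R | forall i, `[-1, 1]%classic (tnth x i)])).
  apply: le_measure; rewrite ?inE.
  - by rewrite unit_ballE; exact: measurable_ball_at.
  - exact: measurable_cube.
  move=> x /=; rewrite enorm_edist => h i; rewrite in_itv/= -ler_norml.
  by apply: le_trans h; have := edist_coord x [tuple 0 | _ < d] i; rewrite tnth_mktuple subr0.
by rewrite lebesgue_cube ?ltry//; lra.
Qed.

Lemma unit_ball_volume_gt0 : 0 < k_.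
Proof.
rewrite -lte_fin -lebesgue_unit_ball.
have d0 : (0 : R) < d%:R by rewrite ltr0n.
(* The cube of side 1/d fits into the unit ball, since the norm is at most d times the largest
   coordinate. *)
apply: (@lt_le_trans _ _ (lebesgue d [set x : d.-tuple R | forall i, `[0, d%:R^-1]%classic (tnth x i)])).
  by rewrite lebesgue_cube ?subr0 ?lte_fin ?exprn_gt0 ?invr_gt0// invr_ge0 ltW.
apply: le_measure; rewrite ?inE.
- exact: measurable_cube.
- by rewrite unit_ballE; exact: measurable_ball_at.
move=> x /= h; rewrite enorm_edist.
have -> : 1 = d%:R * d%:R^-1 :> R by rewrite mulfV// gt_eqF.
apply: edist_le_coord; first by rewrite invr_ge0 ltW.
move=> i; rewrite tnth_mktuple subr0; have := h i; rewrite in_itv/= => /andP[? ?].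
by rewrite ger0_norm.
Qed.

Lemma lebesgue_ball_at x r : 0 < r -> lebesgue d (ball_at x r) = (k_ * r ^+ d)%:E.
Proof.
move=> r0; have r'0 : r^-1 != 0 by rewrite invr_eq0 gt_eqF.
pose b := [tuple - (r^-1 * tnth x i) | i < d].
rewrite (_ : ball_at x r = affine r^-1 b @^-1` [set x : d.-tuple R | enorm x <= 1]).
  rewrite lebesgue_affine//; last by rewrite unit_ballE; exact: measurable_ball_at.
  rewrite lebesgue_unit_ball -EFinM gtr0_norm ?invr_gt0// exprVn invrK mulrC//.
apply/seteqP; split => y; rewrite /ball_at/= -/(enorm _);
  rewrite (_ : enorm (affine r^-1 b y) = r^-1 * edist x y) ?ler_pdivrMl ?mulr1//;
  rewrite edistC edistE /enorm -{2}[r^-1]ger0_norm ?invr_ge0 ?(ltW r0)// -sqrtr_sqr -sqrtrM ?sqr_ge0//;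
  congr Num.sqrt; rewrite mulr_sumr; apply: eq_bigr => i _; rewrite !tnth_mktuple; ring.
Qed.

(* If |x - y| > r, the reflection through y maps the intersection of the two
   balls into the part of the ball at y outside the ball at x. *)
Lemma lebesgue_ball_lens x y r : 0 < r -> r < edist x y ->
  (lebesgue d (ball_at x r `&` ball_at y r) <= (k_ * r ^+ d / 2)%:E)%E.
Proof.
move=> r0 rxy; set C := _ `&` _.
have mC : measurable C by apply: measurableI; exact: measurable_ball_at.
pose b := [tuple 2 * tnth y i | i < d].
have N10 : (-1 : R) != 0 by rewrite oppr_eq0 oner_eq0.
have rfl z : edist y (affine (-1) b z) = edist y z.
  rewrite !edistE; congr Num.sqrt; apply: eq_bigr => i _.
  by rewrite !tnth_mktuple -sqrrN; congr (_ ^+ 2); ring.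
(* The parallelogram law: if z and its mirror image were both within r of x, then so would be their
   midpoint y. *)
have par z : edist x z ^+ 2 + edist x (affine (-1) b z) ^+ 2 =
    2 * edist x y ^+ 2 + 2 * edist y z ^+ 2.
  rewrite !sqr_edist !mulr_sumr -!big_split; apply: eq_bigr => i _ /=.
  by rewrite !tnth_mktuple; ring.
have mC' : measurable (affine (-1) b @^-1` C).
  rewrite (_ : _ @^-1` _ = (fun z => edist x (affine (-1) b z)) @^-1` `]-oo, r]%classic
     `&` ball_at y r).
    apply: measurableI; last exact: measurable_ball_at.
    rewrite -[X in measurable X]setTI.
    apply: (measurableT_comp (measurable_edist x)) => //.
    apply/measurable_fun_tnthP => i /=.
    rewrite (_ : _ \o _ = (fun z => - 1 * tnth z i + tnth b i)).
      apply: measurable_funD => //; apply: measurable_funM => //; exact: measurable_tnth.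
    by apply/funext => z /=; rewrite tnth_mktuple.
  by apply/seteqP; split => z; rewrite /C /ball_at/= in_itv/= rfl.
have disj : C `&` (affine (-1) b @^-1` C) = set0.
  apply/seteqP; split => z //; rewrite /C /ball_at/= => -[[xz yz] [xz' _]].
  have : edist x y ^+ 2 <= r ^+ 2.
    have := par z; have := sqr_ge0 (edist y z).
    have : edist x z ^+ 2 <= r ^+ 2 by rewrite ler_pXn2r ?nnegrE ?edist_nonneg ?(ltW r0).
    have : edist x (affine (-1) b z) ^+ 2 <= r ^+ 2 by rewrite ler_pXn2r ?nnegrE ?edist_nonneg ?(ltW r0).
    by lra.
  by rewrite ler_pXn2r ?nnegrE ?edist_nonneg ?(ltW r0)// leNgt rxy.
have : (lebesgue d C + lebesgue d (affine (-1) b @^-1` C) <= lebesgue d (ball_at y r))%E.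
  rewrite -measureU//; apply: le_measure; rewrite ?inE.
  - exact: measurableU.
  - exact: measurable_ball_at.
  by move=> z; rewrite /C /ball_at/= rfl => -[[]//|[]//].
rewrite lebesgue_affine// normrN1 expr1n invr1 mul1e lebesgue_ball_at//.
have : lebesgue d C \is a fin_num.
  rewrite ge0_fin_numE//; apply: (@le_lt_trans _ _ (lebesgue d (ball_at y r))).
    by apply: le_measure; rewrite ?inE//; [exact: measurable_ball_at|move=> z []].
  by rewrite lebesgue_ball_at ?ltry.
by case: (lebesgue d C) => // c _; rewrite !lee_fin; lra.
Qed.

End ball_volume.

(** * Occupied cells of a Poisson process *)

Lemma measure_bigcup_finType d (T : measurableType d) (R : realType)
    (mu : {measure set T -> \bar R}) (K : finType) (J : {set K}) (F : K -> set T) :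
  (forall k, measurable (F k)) -> trivIset setT F ->
  mu (\bigcup_(k in [set` J]) F k) = (\sum_(k in J) mu (F k))%E.
Proof.
move=> mF tF; rewrite measure_fin_bigcup//.
- rewrite -(@bigfs _ _ _ _ (index_enum K)) ?index_enum_uniq//.
  by move=> i _; rewrite mem_index_enum.
- exact: sub_trivIset tF.
Qed.

Section counting_facts.
Context {T : choiceType} {R : realType}.
Local Open Scope ereal_scope.

Lemma counting_eq0 (A : set T) : (counting A = 0 :> \bar R) <-> A = set0.
Proof.
rewrite /counting; split=> [|->]; last by rewrite asboolT// fset_set0.
case: ifPn => // /asboolP finA [] /eqP; rewrite pnatr_eq0 finmap.cardfs_eq0 => /eqP.
exact: fset_set_set0.
Qed.

Lemma counting_image_inj (K : finType) (J : {set K}) (f : K -> T) :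
  {in J &, injective f} -> counting [set f k | k in [set` J]] = #|J|%:R%:E :> \bar R.
Proof.
move=> finj; rewrite /counting asboolT; last exact: finite_image.
congr (_%:R%:E); apply: card_fset_set.
apply: card_eq_trans; first by apply: inj_card_eq => x y; rewrite !inE; exact: finj.
have -> : [set` J] = [set (enum_val i : K) | i in [set: 'I_#|J|]].
  apply/seteqP; split => [k kJ|_ [i _ <-]]; last exact: enum_valP.
  by exists (enum_rank_in kJ k) => //; rewrite enum_rankK_in.
have -> : `I_#|J| = [set (i : nat) | i in [set: 'I_#|J|]].
  apply/seteqP; split => [i iJ|_ [i _ <-]]; last exact: ltn_ord.
  by exists (Ordinal iJ).
apply: card_eq_trans; first by apply: inj_card_eq => x y _ _; exact: enum_val_inj.
by rewrite card_eq_sym; apply: inj_card_eq => x y _ _; exact: val_inj.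
Qed.

End counting_facts.

Section nat_values_facts.
Context {R : realType}.
Local Open Scope ereal_scope.

Lemma nat_valuesP (A : set nat) (n : nat) : nat_values A (n%:R%:E : \bar R) <-> A n.
Proof.
split=> [[m Am [] /eqP]|An]; last by exists n.
by rewrite eqr_nat => /eqP <-.
Qed.

Lemma measurable_nat_values (A : set nat) : measurable (nat_values A : set (\bar R)).
Proof.
rewrite (_ : nat_values A = \bigcup_(n in A) [set n%:R%:E]).
  by apply: bigcup_measurable => n _; exact: emeasurable_set1.
by apply/seteqP; split => [_ [n An <-]|x [n An ->]]; exists n.
Qed.

Lemma nat_values0 : nat_values [set 0%N] = [set 0 : \bar R].
Proof. by apply/seteqP; split => [_ [n -> <-]|_ ->]//; exists 0%N. Qed.

Lemma poisson_prob_set0 (m : R) : (0 <= m)%R ->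
  poisson_prob m 0 [set 0%N] = (expR (- m))%:E.
Proof.
rewrite le_eqVlt => /orP[/eqP <-|m0].
  by rewrite /poisson_prob ltxx diracE mem_set// oppr0 expR0.
rewrite /poisson_prob m0 esum_set1 ?lee_fin ?poisson_pmf_ge0//.
by rewrite poisson_pmf0.
Qed.

End nat_values_facts.

Section occupancy.
Context {R : realType} {d : nat} {dO : measure_display} {Om : measurableType dO}.
Variables (P : probability Om R) (t : R) (t_gt0 : 0 < t).
Variable eta : Om -> set (d.-tuple R).
Hypothesis eta_poisson : is_poisson_process P (fun B => (t%:E * lebesgue d B)%E) eta.
Local Notation vol B := (fine (lebesgue d B)).

Lemma num_points_eq0 (B : set (d.-tuple R)) w :
  num_points eta B w = 0%E <-> eta w `&` B = set0.
Proof. exact: counting_eq0. Qed.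

Lemma measurable_num_points B (S : set (\bar R)) : measurable B -> measurable S ->
  measurable (num_points eta B @^-1` S).
Proof.
by move=> mB mS; rewrite -[X in measurable X]setTI; apply: (poisson_process_measurable eta_poisson).
Qed.

Lemma prob_empty B : measurable B -> (lebesgue d B < +oo)%E ->
  P (num_points eta B @^-1` [set 0%E]) = (expR (- (t * vol B)))%:E.
Proof.
move=> mB Boo; rewrite -nat_values0 (poisson_process_law eta_poisson)//; last first.
  by rewrite lte_mul_pinfty// ?lee_fin ?ltW.
rewrite fineM//; last by rewrite ge0_fin_numE.
by rewrite poisson_prob_set0// mulr_ge0 ?fine_ge0// ltW.
Qed.

Variables (K : finType) (D : K -> set (d.-tuple R)).
Hypotheses (mD : forall k, measurable (D k)) (tD : trivIset setT D).
Hypothesis D_lty : forall k, (lebesgue d (D k) < +oo)%E.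

Definition occupied (S : set (d.-tuple R)) : {set K} :=
  [set k | `[< S `&` D k !=set0 >]]%SET.

Definition occ_prob k : R := 1 - expR (- (t * vol (D k))).

Lemma occ_prob01 k : 0 <= occ_prob k <= 1.
Proof.
have h : 0 <= t * vol (D k) by rewrite mulr_ge0 ?fine_ge0// ltW.
rewrite /occ_prob subr_ge0 gerBl expR_ge0 andbT.
by rewrite -expR0 ler_expR oppr_le0.
Qed.

Lemma in_occupied S k : (k \in occupied S) <-> S `&` D k !=set0.
Proof. by rewrite inE; split => /asboolP. Qed.

Let E (s : {set K}) (k : K) : set (\bar R) := if k \in s then ~` [set 0%E] else [set 0%E].

Let mE s k : measurable (E s k).
Proof.
by rewrite /E; case: ifP => _; [apply: measurableC|]; exact: emeasurable_set1.
Qed.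

Let occupiedE (s : {set K}) : [set w | occupied (eta w) = s] =
  [set w | forall i : 'I_#|K|, E s (enum_val i) (num_points eta (D (enum_val i)) w)].
Proof.
have key w k : E s k (num_points eta (D k) w) <-> (k \in occupied (eta w)) = (k \in s).
  rewrite /E; case: (boolP (k \in s)) => ks /=.
    rewrite num_points_eq0; split.
      by move=> /eqP/set0P ?; apply/in_occupied.
    by move=> /in_occupied/set0P/eqP.
  rewrite num_points_eq0; split=> [e|].
    by apply/negbTE/negP => /in_occupied; rewrite e => -[].
  move=> /negbT h; apply/eqP/negPn; apply: contra h => /set0P ?.
  by apply/in_occupied.
apply/seteqP; split => w /=.
  by move=> ws i; apply/key; rewrite ws.
move=> h; apply/setP => k; rewrite -(enum_rankK k); apply/key; exact: h.
Qed.

Lemma measurable_occupied s : measurable [set w | occupied (eta w) = s].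
Proof.
rewrite occupiedE (_ : [set w | _] = \bigcap_(i in [set: 'I_#|K|])
   (num_points eta (D (enum_val i)) @^-1` E s (enum_val i))); last first.
  by apply/seteqP; split => w h i; [move=> _; exact: h|exact: h].
by apply: fin_bigcap_measurable => // i _; exact: measurable_num_points.
Qed.

(** This identifies the occupied cells with the coin-flip model: disjoint cells are independent, and
    a cell is vacant with probability exp(-t vol). *)
Lemma occupied_law s : P [set w | occupied (eta w) = s] = (weight occ_prob s)%:E.
Proof.
rewrite occupiedE.
have tD' : trivIset setT (fun i : 'I_#|K| => D (enum_val i)).
  apply/trivIsetP => i j _ _ ij; move/trivIsetP : tD; apply => //.
  by apply: contra ij => /eqP/enum_val_inj ->.
rewrite (poisson_process_independent eta_poisson (B := fun i : 'I_#|K| => D (enum_val i)) _ tD' (A := fun i => E s (enum_val i)))//.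
rewrite (_ : weight _ _ = \prod_(i < #|K|)
   (if enum_val i \in s then occ_prob (enum_val i) else 1 - occ_prob (enum_val i))).
  rewrite -prodEFin; apply: eq_bigr => i _; rewrite /E /occ_prob; case: ifP => _.
    rewrite -preimage_setC probability_setC ?prob_empty//.
    exact: measurable_num_points.
  by rewrite prob_empty// subKr.
by rewrite /weight (reindex _ (onW_bij _ (enum_val_bij K))).
Qed.

Lemma occupied_prob (Q : pred {set K}) :
  P [set w | Q (occupied (eta w))] = (mean occ_prob (fun s => (Q s)%:R))%:E.
Proof.
rewrite (_ : [set w | _] = \bigcup_(s in [set` [set s | Q s]%SET]) [set w | occupied (eta w) = s]).
  rewrite measure_bigcup_finType; last 2 first.
  - exact: measurable_occupied.
  - by apply/trivIsetP => s s' _ _ ss'; apply/seteqP; split => w //= -[ws ws']; move: ss'; rewrite -ws -ws' eqxx.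
  rewrite (eq_bigr _ (fun s _ => occupied_law s)) sumEFin /mean; congr EFin.
  rewrite big_mkcond; apply: eq_bigr => s _; rewrite inE.
  by case: (Q s); rewrite ?mulr1 ?mulr0.
apply/seteqP; split => w /=.
  by move=> Qw; exists (occupied (eta w)) => //=; rewrite inE.
by move=> [s /=]; rewrite inE => Qs ->.
Qed.

Lemma measurable_occupied_fun d' (T : measurableType d') (f : {set K} -> T) :
  measurable_fun setT (fun w => f (occupied (eta w))).
Proof.
move=> _ Y mY; rewrite setTI.
rewrite (_ : _ @^-1` _ = \bigcup_(s in [set s | Y (f s)]) [set w | occupied (eta w) = s]).
  by apply: fin_bigcup_measurable => // s _; exact: measurable_occupied.
by apply/seteqP; split => w /=; [move=> ?; exists (occupied (eta w))|move=> [s ? ->]].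
Qed.

End occupancy.

(** * Meshes of small cells and isolated points *)

Section meshes.
Context {R : realType} {d : nat}.

Record mesh (delta rho : R) := Mesh {
  mesh_index : finType ;
  mesh_cell : mesh_index -> set (d.-tuple R) ;
  mesh_measurable : forall k, measurable (mesh_cell k) ;
  mesh_disjoint : forall k l x, mesh_cell k x -> mesh_cell l x -> k = l ;
  mesh_cover : forall x, enorm x <= rho -> exists k, mesh_cell k x ;
  mesh_diam : forall k x y, mesh_cell k x -> mesh_cell k y -> edist x y <= delta }.

Lemma mesh_exists (d_gt0 : (0 < d)%N) (delta rho : R) : 0 < delta -> 0 < rho ->
  mesh delta rho.
Proof.
move=> delta0 rho0.
have d0 : 0 < d%:R :> R by rewrite ltr0n.
(* Half-open cubes of this side have diameter at most delta by [edist_le_coord]; N of them per axis,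
   starting at -rho, reach past rho. *)
pose h := delta / d%:R.
have h0 : 0 < h by rewrite divr_gt0.
pose N := (Num.truncn (2 * rho / h)).+1.
pose lo j : R := j%:R * h - rho.
pose cell (k : {ffun 'I_d -> 'I_N}) : set (d.-tuple R) :=
  [set x | forall i, `[lo (k i), lo (k i).+1[%classic (tnth x i)].
have uniq_lo j j' (a : R) : a \in `[lo j, lo j.+1[ -> a \in `[lo j', lo j'.+1[ -> j = j'.
  rewrite !in_itv/= /lo => /andP[a1 a2] /andP[b1 b2].
  have : (j%:R : R) < j'.+1%:R by rewrite -(ltr_pM2r h0); lra.
  have : (j'%:R : R) < j.+1%:R by rewrite -(ltr_pM2r h0); lra.
  by rewrite !ltr_nat !ltnS => ? ?; apply/eqP; rewrite eqn_leq; apply/andP.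
apply: (@Mesh _ _ _ cell).
- move=> k; rewrite (_ : cell k = \bigcap_(i in [set: 'I_d])
    ((fun x => tnth x i) @^-1` `[lo (k i), lo (k i).+1[%classic)).
    apply: fin_bigcap_measurable => // i _.
    rewrite -[X in measurable X]setTI; apply: (measurable_tnth i) => //.
  by apply/seteqP; split => x hx i; [move=> _; exact: hx|exact: hx].
- move=> k l x kx lx; apply/ffunP => i; apply: val_inj.
  exact: uniq_lo (kx i) (lx i).
- move=> x xrho.
  pose a i := (tnth x i + rho) / h.
  have xi i : `|tnth x i| <= rho.
    apply: le_trans xrho; rewrite enorm_edist.
    by have := edist_coord x [tuple 0 | _ < d] i; rewrite tnth_mktuple subr0.
  have a0 i : 0 <= a i.
    by rewrite divr_ge0 ?(ltW h0)//; have := xi i; rewrite ler_norml; lra.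
  have aN i : (Num.truncn (a i) < N)%N.
    rewrite ltnS le_truncn// ler_pM2r ?invr_gt0//.
    by have := xi i; rewrite ler_norml; lra.
  exists [ffun i => Ordinal (aN i)] => i; rewrite /= ffunE/= in_itv/= /lo.
  have /andP[] := truncn_itv (a0 i).
  by rewrite ler_pdivlMr// ltr_pdivrMr//; lra.
- move=> k x y kx ky.
  have -> : delta = d%:R * h by rewrite /h; field; rewrite gt_eqF.
  apply: edist_le_coord; first exact: ltW.
  move=> i; have := kx i; have := ky i; rewrite /= !in_itv/= /lo -natr1 mulrDl mul1r.
  by move=> /andP[? ?] /andP[? ?]; rewrite ler_norml; lra.
Qed.

End meshes.

Section isolated_points.
Context {R : realType} {d : nat}.
Implicit Types (S W : set (d.-tuple R)) (x y : d.-tuple R).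

Definition isolated_pts (r : R) S : set (d.-tuple R) :=
  [set x | S x /\ forall y, S y -> y <> x -> r < edist x y].

Variables (W : set (d.-tuple R)) (r delta rho : R) (M : mesh (d := d) delta rho).
Hypothesis mW : measurable W.

Local Notation K := (mesh_index M * bool)%type.
Implicit Types p q : K.

(* Cells are cut along the window and along the ball of radius rho, outside
   of which the mesh need not cover. *)
Definition cell p : set (d.-tuple R) :=
  mesh_cell p.1 `&` (if p.2 then W else ~` W) `&` [set x | enorm x <= rho].
(** One pair of points within r suffices, so any points of neighbouring cells are within r + 2
    delta. Equality is added to make the relation reflexive on empty cells too. *)
Definition nbr p q := (p == q) ||
  `[< exists x y, [/\ cell p x, cell q y & edist x y <= r] >].
(** A point of the cell serves as the centre when its neighbourhood is compared with balls. *)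
Definition window_cells : {set K} := [set p : K | p.2 && `[< cell p !=set0 >]]%SET.

Lemma nbr_refl : reflexive nbr.
Proof. by move=> p; rewrite /nbr eqxx. Qed.

Lemma nbr_sym : symmetric nbr.
Proof.
move=> p q; rewrite /nbr eq_sym; congr orb; apply/asboolP/asboolP;
  by move=> [x [y [? ? ?]]]; exists y, x; rewrite edistC.
Qed.

Lemma measurable_cell p : measurable (cell p).
Proof.
apply: measurableI.
  apply: measurableI; first exact: mesh_measurable.
  by case: p.2 => //; exact: measurableC.
rewrite (_ : [set x | _] = ball_at [tuple 0 | _ < d] rho); first exact: measurable_ball_at.
by apply/seteqP; split => x /=; rewrite /ball_at/= edistC enorm_edist.
Qed.

Lemma cell_inj p q x : cell p x -> cell q x -> p = q.
Proof.
case: p q => [k b] [l c] [[/= kx bx] _] [[/= lx cx] _].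
congr pair; first exact: mesh_disjoint kx lx.
by move: bx cx; case: b; case: c.
Qed.

Lemma trivIset_cell : trivIset setT cell.
Proof.
apply/trivIsetP => p q _ _ pq; apply/seteqP; split => x // [px qx].
by move: pq; rewrite (cell_inj px qx) eqxx.
Qed.

Lemma cell_diam p x y : cell p x -> cell p y -> edist x y <= delta.
Proof. by move=> [[px _] _] [[py _] _]; exact: mesh_diam px py. Qed.

Lemma cell_cover x : enorm x <= rho -> exists2 p, cell p x & (p.2 <-> W x).
Proof.
move=> xrho; have [k kx] := mesh_cover M xrho.
exists (k, `[< W x >]); last by split => [/asboolP|?]//=; apply/asboolP.
by split=> //; split=> //=; case: asboolP.
Qed.

Variable m : R.
Hypotheses (Wm : forall x, W x -> enorm x <= m) (mr_rho : m + r <= rho) (r_ge0 : 0 <= r).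

Lemma enorm_le_edist x y : enorm y <= enorm x + edist x y.
Proof.
rewrite (enorm_edist x) (enorm_edist y) [leRHS]addrC (edistC x y).
exact: (ler_edistD x y).
Qed.

(** The first half of the separation hypothesis puts at most one point into a cell. The second says
    that no distance lies in ]r, r + 2 delta], so isolation of the cell and of its point agree. The
    mesh must reach r beyond the window, because points outside W also destroy isolation. *)
Lemma count_isolated S :
  (forall x y, S x -> S y -> enorm x <= rho -> enorm y <= rho -> x <> y ->
    delta < edist x y /\ (r < edist x y -> r + 2 * delta < edist x y)) ->
  counting (isolated_pts r S `&` W) =
  (#|Iso nbr window_cells (occupied cell S)|%:R)%:E :> \bar R.
Proof.
move=> sep; set J := Iso _ _ _.
pose f p := xget [tuple 0 | _ < d] (S `&` cell p).
have fP p : p \in occupied cell S -> S (f p) /\ cell p (f p).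
  by move=> /in_occupied[x Sx]; exact: (xgetPex _ (ex_intro _ x Sx)).
have JP p : p \in J -> [/\ p \in occupied cell S, p.2 &
    forall q, q != p -> nbr p q -> q \notin occupied cell S].
  by rewrite inE => /andP[]; rewrite inE => /andP[p2 _] /isoP[pS h]; split.
have same p x y : S x -> S y -> cell p x -> cell p y -> x = y.
  move=> Sx Sy px py; apply: contrapT => xy.
  have [] := sep x y Sx Sy px.2 py.2 xy.
  by rewrite ltNge (cell_diam px py).
rewrite -(@counting_image_inj _ _ _ J f); last first.
  move=> p q /JP[pS _ _] /JP[qS _ _] fpq; apply: (@cell_inj p q (f p)).
    by case: (fP p).
  by rewrite fpq; case: (fP q).
congr counting; apply/seteqP; split => [x [[Sx xiso] Wx]|_ [p pJ <-]]; last first.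
  have [pS p2 piso] := JP p pJ.
  have [Sx px] := fP p pS.
  have Wx : W (f p) by case: px => -[_]; rewrite p2.
  split=> //; split=> // y Sy yx; rewrite ltNge; apply/negP => xy.
  have yrho : enorm y <= rho.
    apply: le_trans (enorm_le_edist (f p) y) _; apply: le_trans mr_rho.
    by apply: lerD => //; exact: Wm.
  have [q qy _] := cell_cover yrho.
  have qp : q != p.
    by apply/eqP => qp; apply: yx; apply: (same p) => //; rewrite -qp.
  have pq : nbr p q by apply/orP; right; apply/asboolP; exists (f p), y.
  have /negP := piso q qp pq; apply; apply/in_occupied; by exists y.
have xrho : enorm x <= rho.
  by apply: le_trans (Wm Wx) _; apply: le_trans mr_rho; rewrite lerDl.
have [p px pW] := cell_cover xrho.
have pS : p \in occupied cell S by apply/in_occupied; exists x.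
have [Sfp pfp] := fP p pS.
exists p; last exact: (same p).
rewrite /= inE /window_cells inE; apply/andP; split.
  by apply/andP; split; [exact/pW|apply/asboolP; exists x].
apply/isoP; split=> // q qp; rewrite /nbr eq_sym (negbTE qp)/=.
move=> /asboolP[x' [y' [px' qy' xy']]]; apply/negP => /in_occupied[y [Sy qy]].
have xy : x <> y.
  by move=> xy; move: qp; rewrite (@cell_inj p q x)// ?eqxx// xy.
have [_] := sep x y Sx Sy px.2 qy.2 xy.
move=> /(_ (xiso y Sy (nesym xy))); apply/negP; rewrite -leNgt.
have := ler_edistD x' x y; have := ler_edistD y' x' y.
have := cell_diam px px'; have := cell_diam qy' qy; lra.
Qed.

End isolated_points.

(** * Masses of neighbourhoods and the bounds for a fixed mesh *)

Section cell_masses.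
Context {R : realType} {d : nat} (d_gt0 : (0 < d)%N).
Variables (W : set (d.-tuple R)) (mW : measurable W).
Variables (t r delta rho m : R) (M : mesh (d := d) delta rho).
Hypotheses (t_gt0 : 0 < t) (r_gt0 : 0 < r) (delta_gt0 : 0 < delta).
Hypotheses (Wm : forall x, W x -> enorm x <= m) (mr_rho : m + r <= rho).

Local Notation K := (mesh_index M * bool)%type.
Implicit Types (p q j : K) (J : {set K}) (x y z : d.-tuple R).
Local Notation cell := (cell (M := M) W).
Local Notation nbr := (nbr (M := M) W r).
Local Notation Kw := (window_cells W M).
Local Notation near1 := (near1 nbr).
Local Notation near2 := (near2 nbr).
Local Notation near4 := (near4 nbr).
Local Notation vol B := (fine (lebesgue d B)).
Local Notation k_ := (unit_ball_volume R d).

(** Below, v is the mass of a ball of radius r, V bounds the mass of a cell neighbourhood and mu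
    that of one cell; refining the mesh sends V to v and mu to 0. *)
Definition ball_mass (s : R) : R := t * (k_ * s ^+ d).
Local Notation v := (ball_mass r).
Local Notation V := (ball_mass (r + 2 * delta)).
Local Notation mu := (ball_mass delta).

Definition cell_mass p : R := t * vol (cell p).
Definition mass J : R := \sum_(p in J) cell_mass p.

Let k_gt0 : 0 < k_. Proof. exact: unit_ball_volume_gt0. Qed.

Lemma cell_lty p : (lebesgue d (cell p) < +oo)%E.
Proof.
have [->|/set0P[x px]] := eqVneq (cell p) set0; first by rewrite measure0 ltry.
apply: (@le_lt_trans _ _ (lebesgue d (ball_at x delta))).
  apply: le_measure; rewrite ?inE; [exact: measurable_cell|exact: measurable_ball_at|].
  by move=> y; exact: cell_diam px.
by rewrite lebesgue_ball_at ?ltry.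
Qed.

Lemma cell_mass_ge0 p : 0 <= cell_mass p.
Proof. by rewrite mulr_ge0 ?fine_ge0// ltW. Qed.

Lemma massE J : mass J = t * vol (\bigcup_(p in [set` J]) cell p).
Proof.
rewrite measure_bigcup_finType//; last 2 first.
- by move=> p; exact: measurable_cell.
- exact: trivIset_cell.
rewrite (eq_bigr (fun p => (vol (cell p))%:E)); last first.
  by move=> p _; rewrite fineK// ge0_fin_numE//; exact: cell_lty.
by rewrite sumEFin/= mulr_sumr.
Qed.

Lemma measurable_cells J : measurable (\bigcup_(p in [set` J]) cell p).
Proof. by apply: fin_bigcup_measurable => // p _; exact: measurable_cell. Qed.

Lemma cells_lty J : (lebesgue d (\bigcup_(p in [set` J]) cell p) < +oo)%E.
Proof.
rewrite measure_bigcup_finType//; last 2 first.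
- by move=> p; exact: measurable_cell.
- exact: trivIset_cell.
by apply: lte_sum_pinfty => p _; exact: cell_lty.
Qed.

Lemma le_vol (A B : set (d.-tuple R)) : measurable A -> measurable B -> A `<=` B ->
  (lebesgue d B < +oo)%E -> vol A <= vol B.
Proof.
move=> mA mB AB Boo; have AleB : (lebesgue d A <= lebesgue d B)%E.
  by apply: le_measure; rewrite ?inE.
rewrite fine_le// ge0_fin_numE//; exact: le_lt_trans Boo.
Qed.

Lemma mass_le_ball J x s : 0 < s ->
  (forall p y, p \in J -> cell p y -> edist x y <= s) -> mass J <= ball_mass s.
Proof.
move=> s0 h; rewrite massE /ball_mass ler_pM2l//.
rewrite (_ : k_ * s ^+ d = vol (ball_at x s)); last by rewrite lebesgue_ball_at.
apply: le_vol.
- exact: measurable_cells.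
- exact: measurable_ball_at.
- by move=> y [p pJ py]; exact: h pJ py.
- by rewrite lebesgue_ball_at ?ltry.
Qed.

Lemma le_mass J (A : set (d.-tuple R)) : measurable A ->
  A `<=` \bigcup_(p in [set` J]) cell p -> t * vol A <= mass J.
Proof.
move=> mA AJ; rewrite massE ler_pM2l//.
apply: le_vol => //; [exact: measurable_cells|exact: cells_lty].
Qed.

Lemma cell_mass_le p : cell_mass p <= mu.
Proof.
have [p0|/set0P[x px]] := eqVneq (cell p) set0.
  rewrite /cell_mass p0 measure0 mulr0 /ball_mass.
  by rewrite !mulr_ge0 ?exprn_ge0 ?(ltW t_gt0) ?(ltW k_gt0) ?(ltW delta_gt0).
have := @mass_le_ball [set p]%SET x delta delta_gt0.
rewrite /mass big_set1; apply => q y; rewrite inE => /eqP ->; exact: cell_diam px.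
Qed.

Lemma mass_window : mass Kw = t * vol W.
Proof.
rewrite massE; congr (_ * fine (lebesgue d _)); apply/seteqP; split => x.
  move=> [p /=]; rewrite inE => /andP[p2 _] [[_]]; by rewrite p2.
move=> Wx; have xrho : enorm x <= rho.
  by apply: le_trans (Wm Wx) _; apply: le_trans mr_rho; rewrite lerDl ltW.
have [p px pW] := cell_cover W M xrho.
exists p => //=; rewrite inE; apply/andP; split; first exact/pW.
by apply/asboolP; exists x.
Qed.

Lemma cell_windowP p : p \in Kw -> exists x, [/\ cell p x, W x & enorm x <= m].
Proof.
rewrite inE => /andP[p2 /asboolP[x px]]; exists x.
have Wx : W x by case: px => -[_]; rewrite p2.
by split=> //; exact: Wm.
Qed.

Lemma nbr_dist p q x y : cell p x -> cell q y -> nbr p q -> edist x y <= r + 2 * delta.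
Proof.
move=> px qy /orP[/eqP pq|/asboolP[x' [y' [px' qy' xy']]]].
  rewrite -pq in qy; have := cell_diam px qy; move: r_gt0 delta_gt0.
  by move: (edist x y) => e; lra.
have := ler_edistD x' x y; have := ler_edistD y' x' y.
have := cell_diam px px'; have := cell_diam qy' qy.
move: xy'; move: (edist x y) (edist x x') (edist x' y) (edist y' y) (edist x' y').
move=> a b c e f *; lra.
Qed.

Lemma nbr_nonempty p q x : cell p x -> nbr p q -> cell q !=set0.
Proof.
move=> px /orP[/eqP <-|/asboolP[_ [y [_ qy _]]]]; by [exists x|exists y].
Qed.

(** Cells are required to be nonempty so that the triangle inequality can pass through a point of an
    intermediate cell in [within_grow]. *)
Definition within x (s : R) J := forall p, p \in J ->
  cell p !=set0 /\ forall y, cell p y -> edist x y <= s.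

Lemma within_near1 p x : cell p x -> within x (r + 2 * delta) (near1 p).
Proof.
move=> px q; rewrite inE => pq; split; first exact: nbr_nonempty px pq.
by move=> y qy; exact: nbr_dist pq.
Qed.

Lemma within_grow x s J : within x s J -> within x (s + (r + 2 * delta)) (grow nbr J).
Proof.
move=> h q /growP[p /h[[z pz] ph] pq]; split; first exact: nbr_nonempty pz pq.
move=> y qy; apply: le_trans (ler_edistD z x y) _; apply: lerD; first exact: ph.
exact: nbr_dist pq.
Qed.

Lemma mass_within x s J : 0 < s -> within x s J -> mass J <= ball_mass s.
Proof. by move=> s0 h; apply: (mass_le_ball s0) => p y pJ; have [_] := h p pJ; apply. Qed.

Let rd_gt0 : 0 < r + 2 * delta. Proof. by move: r_gt0 delta_gt0; lra. Qed.

Lemma ball_massM (n : nat) (s : R) : ball_mass (n%:R * s) = n%:R ^+ d * ball_mass s.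
Proof. by rewrite /ball_mass exprMn; ring. Qed.

Lemma mass_near1_le p : p \in Kw -> mass (near1 p) <= V.
Proof. by move=> /cell_windowP[x [px _ _]]; exact: mass_within (within_near1 px). Qed.

(** Doubling the radius multiplies volume by 2^d: this is the 2^d of the total variation bound. The
    4^d for [near4] arises in the same way. *)
Lemma mass_near2_le p : p \in Kw -> mass (near2 p) <= 2 ^+ d * V.
Proof.
move=> /cell_windowP[x [px _ _]]; rewrite -(ball_massM 2).
apply: (@mass_within x); first by rewrite mulr_gt0.
by rewrite mulr_natl mulr2n; exact/within_grow/within_near1.
Qed.

Lemma mass_near4_le p : p \in Kw -> mass (near4 p) <= 4 ^+ d * V.
Proof.
move=> /cell_windowP[x [px _ _]]; rewrite -(ball_massM 4).
apply: (@mass_within x); first by rewrite mulr_gt0.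
rewrite (_ : 4%:R * _ = r + 2 * delta + (r + 2 * delta) + (r + 2 * delta) + (r + 2 * delta)); last by ring.
by do 3 apply: within_grow; exact: within_near1.
Qed.

Lemma ball_window y z : W y -> edist y z <= r -> enorm z <= rho.
Proof.
move=> Wy yz; apply: le_trans (enorm_le_edist y z) _; apply: le_trans mr_rho.
by apply: lerD => //; exact: Wm.
Qed.

Lemma mass_near1_ge p : p \in Kw -> v <= mass (near1 p).
Proof.
move=> /cell_windowP[x [px Wx _]]; rewrite /ball_mass.
rewrite (_ : k_ * r ^+ d = vol (ball_at x r)); last by rewrite lebesgue_ball_at.
apply: le_mass; first exact: measurable_ball_at.
move=> y xy; have [q qy _] := cell_cover W M (ball_window Wx xy).
by exists q => //=; rewrite inE; apply/orP; right; apply/asboolP; exists x, y.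
Qed.

(** The cells of [near1 p] lie in a ball of radius r + 2 delta, slightly larger than r. Of the ball
    at j the lens takes at most half, and the shell between the two radii costs at most V - v. *)
Lemma mass_near1D_ge p j : p \in Kw -> j \in Kw -> j \notin near1 p ->
  v / 2 - (V - v) <= mass (near1 j :\: near1 p).
Proof.
move=> /cell_windowP[x [px _ _]] /cell_windowP[y [jy Wy _]] pj.
have xy : r < edist x y.
  rewrite ltNge; apply: contra pj => xy; rewrite inE.
  by apply/orP; right; apply/asboolP; exists x, y.
pose s := r + 2 * delta.
have rs : r < s by rewrite /s ltrDl mulr_gt0.
pose A := ball_at y r `\` ball_at x s.
have mB z u : measurable (ball_at z u : set (d.-tuple R)) by exact: measurable_ball_at.
have Boo z u : 0 < u -> (lebesgue d (ball_at z u) < +oo)%E.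
  by move=> u0; rewrite lebesgue_ball_at ?ltry.
have volB z u : 0 < u -> vol (ball_at z u) = k_ * u ^+ d.
  by move=> u0; rewrite lebesgue_ball_at.
have mA : measurable A by exact: measurableD.
apply: (@le_trans _ _ (t * vol A)); last first.
  apply: le_mass => // z [yz xz]; have [q qz _] := cell_cover W M (ball_window Wy yz).
  exists q => //=; rewrite inE; apply/andP; split.
    rewrite inE; apply/negP => pq; apply: xz; exact: nbr_dist px qz pq.
  by rewrite inE; apply/orP; right; apply/asboolP; exists y, z.
rewrite /ball_mass -/s.
have s0 : 0 < s by [].
(* The ball at y is covered by A, the lens and the shell. *)
have : (lebesgue d (ball_at y r) <= lebesgue d A + (lebesgue d (ball_at x r `&` ball_at y r) +
     lebesgue d (ball_at x s `\` ball_at x r)))%E.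
  apply: (@le_trans _ _ (lebesgue d (A `|` ((ball_at x r `&` ball_at y r) `|`
     (ball_at x s `\` ball_at x r))))).
    apply: le_measure; rewrite ?inE//.
      by apply: measurableU => //; apply: measurableU; [exact: measurableI|exact: measurableD].
    move=> z yz; have [xs|xs] := pselect (ball_at x s z); last by left.
    by right; have [xr|xr] := pselect (ball_at x r z); [left|right].
  apply: le_trans (measureU2 _ _ _) _ => //.
    by apply: measurableU; [exact: measurableI|exact: measurableD].
  apply: leeD => //; apply: measureU2; [exact: measurableI|exact: measurableD].
have lens := lebesgue_ball_lens r_gt0 xy.
have diffE : lebesgue d (ball_at x s `\` ball_at x r) = (k_ * s ^+ d - k_ * r ^+ d)%:E.
  rewrite measureD//; last exact: Boo.
  rewrite setIidr; last by move=> z /= /le_trans; apply; exact: ltW.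
  by rewrite EFinB; congr (_ - _)%E; exact: lebesgue_ball_at.
rewrite diffE lebesgue_ball_at//.
have : lebesgue d A \is a fin_num.
  rewrite ge0_fin_numE//; apply: le_lt_trans (Boo y r r_gt0).
  by apply: le_measure; rewrite ?inE// => z [].
have : lebesgue d (ball_at x r `&` ball_at y r) \is a fin_num.
  rewrite ge0_fin_numE//; exact: le_lt_trans lens (ltry _).
move: lens; case: (lebesgue d A) => // a; case: (lebesgue d _) => // l.
rewrite /= !lee_fin => l1 _ _ l2.
rewrite (_ : _ - _ = t * (k_ * r ^+ d / 2 - (k_ * s ^+ d - k_ * r ^+ d))); last by ring.
rewrite ler_pM2l//.
by move: l1 l2; move: (k_ * r ^+ d) (k_ * s ^+ d) => kr ks; lra.
Qed.

Local Notation q_ := (occ_prob t cell).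

Lemma occ_probE p : q_ p = 1 - expR (- cell_mass p). Proof. by []. Qed.

Lemma occ_prob_le p : q_ p <= cell_mass p.
Proof. by rewrite occ_probE; have := expR_ge1Dx (- cell_mass p); lra. Qed.

Lemma occ_prob_ge p : cell_mass p * (1 - mu) <= q_ p.
Proof.
rewrite occ_probE; have := cell_mass_ge0 p; have := cell_mass_le p.
have := expR_ge1Dx (cell_mass p); have := expR_gt0 (- cell_mass p).
have := expRN (cell_mass p); move: (cell_mass p) => c.
have := expR_gt0 c; move: (expR c) (expR (- c)) => e e' e0 -> e'0 e1 cmu c0.
(* Together with [h] this gives exp(-c) <= 1 - c + c^2, where c^2 <= c mu. *)
have : e^-1 <= (1 + c)^-1 by rewrite lef_pV2 ?posrE//; lra.
have h : (1 + c)^-1 <= 1 - c + c ^+ 2.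
  rewrite -[leLHS]mul1r ler_pdivrMr; last lra.
  have : 0 <= c ^+ 3 by apply: exprn_ge0.
  by rewrite (_ : (1 - c + c ^+ 2) * (1 + c) = 1 + c ^+ 3); [lra|ring].
have : c * c <= c * mu by rewrite ler_wpM2l.
by rewrite -expr2; lra.
Qed.

Lemma prod_vacant J : \prod_(p in J) (1 - q_ p) = expR (- mass J).
Proof.
rewrite /mass -sumrN expR_sum; apply: eq_bigr => p _.
by rewrite occ_probE subKr.
Qed.

Lemma mass_setD1 J j : j \in J -> mass (J :\ j) = mass J - cell_mass j.
Proof.
move=> jJ; rewrite /mass [in RHS](bigD1 j)//= addrC addrK.
by apply: eq_bigl => p; rewrite !inE andbC.
Qed.

(** The occupied cell j is missing from the vacant mass, which costs at most mu in the exponent. *)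
Lemma singleton_le J j c : j \in J -> c <= mass J ->
  q_ j * \prod_(p in J :\ j) (1 - q_ p) <= cell_mass j * expR (mu - c).
Proof.
move=> jJ cJ; rewrite prod_vacant mass_setD1//.
apply: ler_pM; rewrite ?expR_ge0//.
- by case/andP: (occ_prob01 t_gt0 cell j).
- exact: occ_prob_le.
by rewrite ler_expR; have := cell_mass_le j; lra.
Qed.

Local Notation piso := (piso q_ nbr).

Let q01 := occ_prob01 t_gt0 cell.
Let n_refl := @nbr_refl R d W r delta rho M.
Let n_sym := @nbr_sym R d W r delta rho M.

Lemma piso_le j : j \in Kw -> piso j <= cell_mass j * expR (mu - v).
Proof.
move=> jW; rewrite (pisoE q_ nbr); apply: singleton_le.
  by rewrite inE; exact: n_refl.
exact: mass_near1_ge.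
Qed.

Lemma piso_ge j : j \in Kw -> cell_mass j * (1 - mu) * expR (- V) <= piso j.
Proof.
move=> jW; rewrite (pisoE q_ nbr) prod_vacant.
apply: (@le_trans _ _ (q_ j * expR (- V))).
  by rewrite ler_pM2r ?expR_gt0//; exact: occ_prob_ge.
rewrite ler_wpM2l//; first by case/andP: (q01 j).
rewrite ler_expR lerN2; apply: le_trans (mass_near1_le jW).
rewrite mass_setD1 ?inE; last exact: n_refl.
by rewrite gerBl cell_mass_ge0.
Qed.

(** First summand: cells of [near1] isolated beforehand, each needing about a full ball vacant.
    Second: cells of [near2] outside [near1] isolated after emptying, for which only about half a
    ball is certain to remain to be vacant. *)
Definition disturb_bound := V * expR (mu - v) + 2 ^+ d * V * expR (mu - (v / 2 - (V - v))).

Lemma mass_sub J J' : J \subset J' -> mass J <= mass J'.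
Proof.
move=> JJ'; rewrite /mass [leRHS](big_setID J)/=.
by rewrite (finset.setIidPr JJ') lerDl sumr_ge0// => p _; exact: cell_mass_ge0.
Qed.

Lemma mean_disturb_le p : p \in Kw -> mean_disturb q_ nbr Kw p <= disturb_bound.
Proof.
move=> pW; rewrite mean_disturbE; apply: lerD.
  apply: (@le_trans _ _ (mass (Kw :&: near1 p) * expR (mu - v))).
    rewrite /mass mulr_suml; apply: ler_sum => j; rewrite inE => /andP[jW _].
    exact: piso_le.
  rewrite ler_pM2r ?expR_gt0//; apply: le_trans (mass_near1_le pW).
  by apply: mass_sub; exact: subsetIr.
apply: (@le_trans _ _ (mass (Kw :&: (near2 p :\: near1 p)) * expR (mu - (v / 2 - (V - v))))).
  rewrite /mass mulr_suml; apply: ler_sum => j; rewrite inE => /andP[jW].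
  rewrite inE => /andP[jp _]; apply: singleton_le; last exact: mass_near1D_ge.
  by rewrite inE jp inE; exact: n_refl.
rewrite ler_pM2r ?expR_gt0//; apply: le_trans (mass_near2_le pW).
apply: mass_sub; by apply: (fintype.subset_trans (finset.subsetIr _ _)); exact: finset.subsetDl.
Qed.

Lemma sum_piso_near4_le p : p \in Kw ->
  \sum_(j in Kw :&: near4 p) piso j <= 4 ^+ d * V * expR (mu - v).
Proof.
move=> pW; apply: (@le_trans _ _ (mass (Kw :&: near4 p) * expR (mu - v))).
  rewrite /mass mulr_suml; apply: ler_sum => j; rewrite inE => /andP[jW _].
  exact: piso_le.
rewrite ler_pM2r ?expR_gt0//; apply: le_trans (mass_near4_le pW).
by apply: mass_sub; exact: subsetIr.
Qed.

Local Notation w := (vol W).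
Definition mean_lo := t * w * (1 - mu) * expR (- V).
Definition mean_hi := t * w * expR (mu - v).

Lemma sum_piso_bounds : mean_lo <= \sum_(k in Kw) piso k <= mean_hi.
Proof.
rewrite /mean_lo /mean_hi -mass_window /mass !mulr_suml; apply/andP; split.
  by apply: ler_sum => j jW; exact: piso_ge.
by apply: ler_sum => j jW; exact: piso_le.
Qed.

Local Notation E := (mean q_).
Local Notation X s := #|Iso nbr Kw s|.
Variables (lam : R) (lam_gt0 : 0 < lam).

(** The mean of the count lies between [mean_lo] and [mean_hi]; adding the distances of lam to both
    ends bounds the mismatch whatever the position of lam. *)
Definition stein_error (b : R) :=
  (`|lam - mean_lo| + `|lam - mean_hi|) * (expR lam / lam) + mean_hi * (lam^-1 * b).

Let piso_sum := \sum_(k in Kw) piso k.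

Let stein_error_le (b : R) : 0 <= b ->
  `|lam - piso_sum| * (expR lam / lam) + piso_sum * (lam^-1 * b) <= stein_error b.
Proof.
move=> b0; have /andP[lo hi] := sum_piso_bounds.
apply: lerD; last by rewrite ler_wpM2r// mulr_ge0// invr_ge0 ltW.
rewrite ler_wpM2r ?divr_ge0 ?expR_ge0 ?(ltW lam_gt0)//.
have := ler_norm (lam - mean_lo); have := ler_norm (mean_hi - lam).
have := normr_ge0 (lam - mean_lo); have := normr_ge0 (lam - mean_hi).
by rewrite (distrC mean_hi) ler_norml -/piso_sum in lo hi *; lra.
Qed.

Let disturb_bound_ge0 : 0 <= disturb_bound.
Proof.
have V0 : 0 <= V by rewrite /ball_mass !mulr_ge0 ?exprn_ge0 ?(ltW t_gt0) ?(ltW k_gt0) ?(ltW rd_gt0).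
have p2 : (0 : R) <= 2 ^+ d by exact: exprn_ge0.
rewrite /disturb_bound; apply: addr_ge0; apply: mulr_ge0; rewrite ?expR_ge0//.
exact: mulr_ge0.
Qed.

Lemma cells_poisson_bound (f : nat -> R) : (forall k, 0 <= f k <= 1) ->
  `|E (fun s => f (X s)) - poisson_mean lam f| <= stein_error disturb_bound.
Proof.
move=> f01; apply: le_trans (stein_error_le disturb_bound_ge0).
apply: (@stein_lipschitz_bound _ _ _ _ _ q01 n_refl n_sym _ _ _ (stein_sol lam f)) => //.
- exact: mean_disturb_le.
- by move=> n; exact: stein_equation.
- by move=> n; exact: stein_sol_bounded.
- by move=> n; exact: stein_sol_lipschitz.
Qed.

Definition void_bound := disturb_bound *
  (lam^-1 + stein_error disturb_bound + 4 ^+ d * V * expR (mu - v)).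

(** A bootstrap: [cells_poisson_bound] for the test function k -> 1/(k + 1), whose Poisson mean is
    at most 1/lam, bounds the mean of 1/(X + 1) that the decreasing Stein solution asks for. *)
Lemma cells_void_bound :
  `|E (fun s => (X s == 0%N)%:R) - expR (- lam)| <= stein_error void_bound.
Proof.
have V0 : 0 <= V by rewrite /ball_mass !mulr_ge0 ?exprn_ge0 ?(ltW t_gt0) ?(ltW k_gt0) ?(ltW rd_gt0).
have e40 : 0 <= 4 ^+ d * V * expR (mu - v) by
  apply: mulr_ge0; [apply: mulr_ge0 => //; exact: exprn_ge0|exact: expR_ge0].
have se0 b : 0 <= b -> 0 <= stein_error b.
  move=> b0; apply: le_trans (stein_error_le b0).
  have ps0 : 0 <= piso_sum by apply: sumr_ge0 => k _; exact: piso_ge0.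
  by rewrite addr_ge0 ?mulr_ge0 ?normr_ge0 ?expR_ge0 ?invr_ge0 ?(ltW lam_gt0).
have vb0 : 0 <= void_bound.
  apply: mulr_ge0 => //; apply: addr_ge0 => //; apply: addr_ge0; last exact: se0.
  by rewrite invr_ge0 ltW.
apply: le_trans (stein_error_le vb0); rewrite -(poisson_mean_ind0 lam_gt0).
have invS01 k : 0 <= (k.+1%:R : R)^-1 <= 1.
  by rewrite invr_ge0 ler0n invf_le1 ?ltr0n// ler1n.
apply: le_trans (@stein_decreasing_bound _ _ _ _ _ q01 n_refl n_sym _ _ _ (stein_sol lam ind0) ind0 _ lam_gt0
  mean_disturb_le (fun n => stein_equation lam_gt0 _ _)
  (fun n => stein_sol_bounded lam_gt0 _ ind0_01) _ disturb_bound_ge0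
  (stein_sol_ind0_ge0 lam_gt0) (stein_sol_ind0_le lam_gt0)
  (fun m n => @stein_sol_ind0_decr _ _ lam_gt0 m n) sum_piso_near4_le) _.
rewrite lerD2l ler_wpM2l//; first by apply: sumr_ge0 => k _; exact: piso_ge0.
rewrite mulrCA ler_wpM2l ?invr_ge0 ?(ltW lam_gt0)// /void_bound.
rewrite ler_wpM2l// lerD2r.
have := cells_poisson_bound invS01; have := poisson_mean_invS lam_gt0.
rewrite ler_norml => h /andP[_]; move: h; move: (E _) (poisson_mean _ _) => a b; lra.
Qed.

End cell_masses.

(** * Refining the mesh *)

Lemma near_all_seq (T : eqType) (s : seq T) (Q : T -> nat -> Prop) :
  (forall p, p \in s -> \forall n \near \oo, Q p n) ->
  \forall n \near \oo, forall p, p \in s -> Q p n.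
Proof.
elim: s => [|p s IH] h; first by near=> n.
have h1 := h p (mem_head _ _).
have h2 : \forall n \near \oo, forall p, p \in s -> Q p n.
  by apply: IH => p' p's; apply: h; rewrite inE p's orbT.
near=> n => p'; rewrite inE => /orP[/eqP ->|]; first by near: n.
by move: p'; near: n.
Unshelve. all: by end_near. Qed.

(** On the almost sure event D the indicators are eventually constant, so dominated convergence
    applies. *)
Lemma cvg_probability_near d (T : measurableType d) (R : realType)
    (P : probability T R) (D : set T) (E_ : nat -> set T) (E : set T) :
  measurable D -> P D = 1%E -> (forall n, measurable (E_ n)) -> measurable E ->
  (forall w, D w -> \forall n \near \oo, E_ n w <-> E w) ->
  (fun n => P (E_ n)) @ \oo --> P E.
Proof.
move=> mD PD mE_ mE hE.
have PI A : measurable A -> P (A `&` D) = P A.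
  move=> mA; apply/eqP; rewrite eq_le; apply/andP; split.
    by apply: le_measure; rewrite ?inE//; exact: measurableI.
  have PDC : P (~` D) = 0%E by rewrite probability_setC// PD subee.
  rewrite -[leRHS]adde0 -PDC; apply: le_trans (measureU2 _ _ _).
  - apply: le_measure; rewrite ?inE//.
      by apply: measurableU; [exact: measurableI|exact: measurableC].
    by move=> w Aw; have [Dw|Dw] := pselect (D w); [left|right].
  - exact: measurableI.
  - exact: measurableC.
have intE A : measurable A -> (\int[P]_(w in D) (\1_A w : R)%:E)%E = P A.
  by move=> mA; rewrite integral_indic//; exact: PI.
rewrite -intE//; under eq_fun do rewrite -intE//.
apply: (@dominated_cvg _ _ _ P D mD (fun n w => (\1_(E_ n) w : R)%:E) _ (cst 1%E)) => //.
- by move=> n; apply/measurable_EFinP; exact: measurable_indic.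
- move=> w Dw; apply: cvg_near_cst; near=> n.
  have nE : E_ n w <-> E w by near: n; exact: hE.
  have [Ew|Ew] := pselect (E w).
    by rewrite !indicE !mem_set//; exact: nE.2.
  by rewrite !indicE !memNset// => /nE.
- apply: (@integrableS _ _ _ _ setT) => //.
  exact: finite_measure_integrable_cst.
- by move=> n w Dw; rewrite abse_EFin indicE; case: (_ \in _); rewrite ?normr1 ?normr0 lee_fin.
Unshelve. all: by end_near. Qed.

Section limit_of_meshes.
Context {R : realType} {d : nat} (d_gt0 : (0 < d)%N).
Context {dO : measure_display} {Om : measurableType dO}.
Variables (P : probability Om R) (t : R) (t_gt0 : 0 < t).
Variable eta : Om -> set (d.-tuple R).
Hypothesis eta_poisson : is_poisson_process P (fun B => (t%:E * lebesgue d B)%E) eta.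
Variables (r : R) (r_gt0 : 0 < r).

Local Notation v := (@ball_mass R d t r).
Local Notation lam := (t * expR (- v)).

Definition count_iso (W : set (d.-tuple R)) (w : Om) : \bar R :=
  counting (isolated_pts r (eta w) `&` W).

(** A window of volume w has mean lam w in the limit, while the target remains lam; both ends in
    [stein_error] tend to lam w, whence the 2. At w = 1 only b is left. *)
Definition stein_limit (w b : R) := 2 * `|lam - lam * w| * (expR lam / lam) + w * b.
Definition disturb_limit := v * expR (- v) + 2 ^+ d * v * expR (- (v / 2)).
(* disturb_limit times a bound on the mean of 1 / (1 + count), with a
   correction for the isolated points within distance 4 r. *)
Definition void_limit w := disturb_limit *
  (lam^-1 + stein_limit w disturb_limit + 4 ^+ d * v * expR (- v)).

Section bounded_window.
Variables (W : set (d.-tuple R)) (mW : measurable W) (m : R).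
Hypothesis Wm : forall x, W x -> enorm x <= m.
Hypothesis m_ge0 : 0 <= m.

Let delta (n : nat) : R := n.+1%:R^-1.
Let delta_gt0 n : 0 < delta n. Proof. by rewrite invr_gt0 ltr0n. Qed.
Let rho_gt0 : 0 < m + r. Proof. by rewrite ltr_wpDl. Qed.
Let Mn n := mesh_exists d_gt0 (delta_gt0 n) rho_gt0.

Let Kn n : finType := (mesh_index (Mn n) * bool)%type.
Let celln n : Kn n -> set (d.-tuple R) := cell (M := Mn n) W.
Let Xn n (s : {set Kn n}) := #|Iso (nbr (M := Mn n) W r) (window_cells W (Mn n)) s|.
Let qn n := occ_prob t (@celln n).

Lemma cvg_delta : delta @ \oo --> 0.
Proof. exact: cvg_harmonic. Qed.

(** Only the finitely many points in the ball of radius m + r matter. Their pairwise distances are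
    positive, and those exceeding r do so by a positive amount, so a fine mesh meets the hypothesis
    of [count_isolated]. *)
Lemma near_count_iso w : \forall n \near \oo,
  count_iso W w = (Xn (occupied (@celln n) (eta w)))%:R%:E.
Proof.
set S := eta w.
have /finite_seqP[s Ss] := poisson_process_locally_finite eta_poisson w (m + r).
have hs : \forall n \near \oo, forall p, p \in [seq (x, y) | x <- s, y <- s] ->
    p.1 <> p.2 -> delta n < edist p.1 p.2 /\
      (r < edist p.1 p.2 -> r + 2 * delta n < edist p.1 p.2).
  apply: near_all_seq => -[x y] _ /=.
  have [->|xy] := eqVneq x y; first by near=> n.
  have e0 : 0 < edist x y.
    by rewrite lt_neqAle edist_nonneg andbT; apply: contra_neq xy => /esym/edist_eq0.
  have h1 : \forall n \near \oo, delta n < edist x y.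
    by apply: (cvgr_lt 0 cvg_delta).
  have h2 : \forall n \near \oo, r < edist x y -> r + 2 * delta n < edist x y.
    have [rxy|rxy] := ltP r (edist x y); last by near=> n.
    have e0' : 0 < (edist x y - r) / 2 by rewrite divr_gt0// subr_gt0.
    have h : \forall n \near \oo, delta n < (edist x y - r) / 2.
      by apply: (cvgr_lt 0 cvg_delta).
    near=> n => _; have : delta n < (edist x y - r) / 2 by near: n.
    move: (delta n) (edist x y) => a b; lra.
  near=> n => _; split; near: n; [exact: h1|exact: h2].
near=> n; apply: (@count_isolated _ _ W r (delta n) (m + r) (Mn n) m Wm) => //; first exact: ltW.
have hn : forall p, p \in [seq (x, y) | x <- s, y <- s] ->
    p.1 <> p.2 -> delta n < edist p.1 p.2 /\
      (r < edist p.1 p.2 -> r + 2 * delta n < edist p.1 p.2) by near: n; exact: hs.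
move=> x y Sx Sy xrho yrho xy; apply: (hn (x, y)) => //.
have ins z : S z -> enorm z <= m + r -> z \in s.
  by move=> Sz zr; have : [set` s] z by rewrite -Ss; split.
by apply/allpairsP; exists (x, y); split => //; exact: ins.
Unshelve. all: by end_near. Qed.

(** Measurability also comes from the meshes: the count is a pointwise limit of functions of the
    occupied cells. *)
Lemma measurable_count_iso : measurable_fun setT (count_iso W).
Proof.
apply: (@emeasurable_fun_cvg _ _ R setT (fun n w => (Xn (occupied (@celln n) (eta w)))%:R%:E)).
  move=> n; apply: (measurable_occupied_fun eta_poisson _ (fun s => (Xn s)%:R%:E)).
  by move=> p; exact: measurable_cell.
move=> w _; apply: cvg_near_cst; near=> n; apply/esym; near: n.
exact: near_count_iso.
Unshelve. all: by end_near. Qed.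

Lemma cvg_mean_count (A : set nat) :
  (fun n => mean (@qn n) (fun s => \1_A (Xn s))) @ \oo -->
  fine (P (count_iso W @^-1` nat_values A)).
Proof.
have mC : measurable (count_iso W @^-1` nat_values A).
  by rewrite -[X in measurable X]setTI; apply: measurable_count_iso => //; exact: measurable_nat_values.
have e n : ((mean (@qn n) (fun s => \1_A (Xn s)))%:E =
   P [set w | (fun s => Xn s \in A) (occupied (@celln n) (eta w))])%E.
  have := @occupied_prob _ _ _ _ P t t_gt0 eta eta_poisson (Kn n) (@celln n)
    (fun p => measurable_cell mW p) (@trivIset_cell _ _ _ _ _ _)
    (fun p => cell_lty mW (delta_gt0 n) p) (fun s => Xn s \in A).
  by move=> ->; congr EFin; apply: eq_mean => s; rewrite indicE.
suff : (fun n => (mean (@qn n) (fun s => \1_A (Xn s)))%:E) @ \oo -->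
    P (count_iso W @^-1` nat_values A).
  by rewrite -[X in _ --> X]fineK; [move/fine_cvg|exact: fin_num_measure].
under eq_fun do rewrite e.
apply: (@cvg_probability_near _ _ _ P setT) => //.
- exact: probability_setT.
- move=> n; rewrite -[X in measurable X]setTI.
  have := @measurable_occupied_fun _ _ _ _ _ _ _ eta_poisson _ (@celln n) _ _ bool (fun s => Xn s \in A).
  move=> /(_ _ measurableT [set true]); apply => //.
  by move=> p; exact: measurable_cell.
move=> w _; near=> n.
have -> : (count_iso W @^-1` nat_values A) w <-> nat_values A (count_iso W w) by [].
have -> : count_iso W w = (Xn (occupied (@celln n) (eta w)))%:R%:E.
  by near: n; exact: near_count_iso.
by rewrite nat_valuesP /= inE.
Unshelve. all: by end_near. Qed.

Local Notation vol B := (fine (lebesgue d B)).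

Let Vn n := @ball_mass R d t (r + 2 * delta n).
Let mun n := @ball_mass R d t (delta n).

Lemma cvg_ball_mass (u : nat -> R) (a : R) : u @ \oo --> a ->
  (fun n => @ball_mass R d t (u n)) @ \oo --> @ball_mass R d t a.
Proof.
move=> ua; apply: cvgMr; apply: cvgMr.
exact: (continuous_cvg _ (exprn_continuous (n := d) (x := a)) ua).
Qed.

Lemma cvgVn : Vn @ \oo --> v.
Proof.
apply: cvg_ball_mass; rewrite -[X in _ --> X]addr0; apply: cvgD; first exact: cvg_cst.
by rewrite -(mulr0 2); apply: cvgMr; exact: cvg_delta.
Qed.

Lemma cvg_mun : mun @ \oo --> 0.
Proof.
rewrite (_ : 0 = @ball_mass R d t 0); first exact: cvg_ball_mass cvg_delta.
by rewrite /ball_mass expr0n gtn_eqF// !mulr0.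
Qed.

Lemma cvg_expR (u : nat -> R) (a : R) : u @ \oo --> a ->
  (fun n => expR (u n)) @ \oo --> expR a.
Proof. by move=> ua; apply: continuous_cvg ua; exact: continuous_expR. Qed.

Lemma cvg_disturb_bound :
  (fun n => @disturb_bound R d t r (delta n)) @ \oo --> disturb_limit.
Proof.
apply: cvgD; apply: cvgM; first exact: cvgVn.
- apply: cvg_expR; rewrite -[X in _ --> X]add0r; apply: cvgB; [exact: cvg_mun|exact: cvg_cst].
- by apply: cvgMr; exact: cvgVn.
- apply: cvg_expR; rewrite (_ : - (v / 2) = 0 - (v / 2 - (v - v))); last by rewrite subrr subr0 sub0r.
  apply: cvgB; first exact: cvg_mun.
  by apply: cvgB; [exact: cvg_cst|apply: cvgB; [exact: cvgVn|exact: cvg_cst]].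
Qed.

Lemma cvg_stein_error (b : nat -> R) (l : R) : b @ \oo --> l ->
  (fun n => stein_error W t r (delta n) lam (b n)) @ \oo --> stein_limit (vol W) l.
Proof.
move=> bl; have lam0 : 0 < lam by rewrite mulr_gt0 ?expR_gt0.
have clo : (fun n => mean_lo W t r (delta n)) @ \oo --> lam * vol W.
  rewrite (_ : lam * _ = t * vol W * (1 - 0) * expR (- v)); last by rewrite subr0; ring.
  apply: cvgM; last by apply: cvg_expR; apply: cvgN; exact: cvgVn.
  by apply: cvgMr; apply: cvgB; [exact: cvg_cst|exact: cvg_mun].
have chi : (fun n => mean_hi W t r (delta n)) @ \oo --> lam * vol W.
  rewrite (_ : lam * _ = t * vol W * expR (0 - v)); last by rewrite sub0r; ring.
  by apply: cvgMr; apply: cvg_expR; apply: cvgB; [exact: cvg_mun|exact: cvg_cst].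
rewrite /stein_limit (_ : 2 * _ = `|lam - lam * vol W| + `|lam - lam * vol W|); last by ring.
rewrite (_ : vol W * l = lam * vol W * (lam^-1 * l)); last by field; rewrite gt_eqF ?expR_gt0// gt_eqF.
apply: cvgD; apply: cvgM => //.
- by apply: cvgD; apply: cvg_norm; apply: cvgB => //; exact: cvg_cst.
- exact: cvg_cst.
- exact: cvgMr.
Qed.

Lemma cvg_void_bound :
  (fun n => void_bound W t r (delta n) lam) @ \oo --> void_limit (vol W).
Proof.
apply: cvgM; first exact: cvg_disturb_bound.
apply: cvgD.
  by apply: cvgD; [exact: cvg_cst|apply: cvg_stein_error; exact: cvg_disturb_bound].
apply: cvgM; first by apply: cvgMr; exact: cvgVn.
by apply: cvg_expR; rewrite -[X in _ --> X]add0r; apply: cvgB; [exact: cvg_mun|exact: cvg_cst].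
Qed.

Lemma count_iso_bounded (A : set nat) :
  `|fine (P (count_iso W @^-1` nat_values A)) - poisson_mean lam (\1_A)| <=
  stein_limit (vol W) disturb_limit.
Proof.
have lam0 : 0 < lam by rewrite mulr_gt0 ?expR_gt0.
have c2 := cvg_stein_error cvg_disturb_bound.
have c1 : (fun n => `|mean (@qn n) (fun s => \1_A (Xn s)) - poisson_mean lam (\1_A)|) @ \oo -->
    `|fine (P (count_iso W @^-1` nat_values A)) - poisson_mean lam (\1_A)|.
  by apply: cvg_norm; apply: cvgB; [exact: cvg_mean_count|exact: cvg_cst].
apply: (ler_cvg_to c1 c2); near=> n.
apply: (@cells_poisson_bound _ _ d_gt0 W mW t r (delta n) (m + r) m) => //.
by move=> k; rewrite indicE; case: (_ \in _) => /=; lra.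
Unshelve. all: by end_near. Qed.

Lemma count_iso_void_bounded :
  `|fine (P (count_iso W @^-1` nat_values [set 0%N])) - expR (- lam)| <=
  stein_limit (vol W) (void_limit (vol W)).
Proof.
have lam0 : 0 < lam by rewrite mulr_gt0 ?expR_gt0.
have c2 := cvg_stein_error cvg_void_bound.
have c1 : (fun n => `|mean (@qn n) (fun s => \1_[set 0%N] (Xn s)) - expR (- lam)|) @ \oo -->
    `|fine (P (count_iso W @^-1` nat_values [set 0%N])) - expR (- lam)|.
  by apply: cvg_norm; apply: cvgB; [exact: cvg_mean_count|exact: cvg_cst].
apply: (ler_cvg_to c1 c2); near=> n.
have -> : mean (@qn n) (fun s => \1_[set 0%N] (Xn s)) = mean (@qn n) (fun s => (Xn s == 0%N)%:R).
  by apply: eq_mean => s; rewrite indicE; case: eqP => s0; [rewrite mem_set|rewrite memNset].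
exact: (@cells_void_bound _ _ d_gt0 W mW t r (delta n) (m + r) m).
Unshelve. all: by end_near. Qed.

End bounded_window.

Lemma measurable_set1_tuple (x : d.-tuple R) : measurable [set x].
Proof.
rewrite (_ : [set x] = ball_at x 0); first exact: measurable_ball_at.
apply/seteqP; split => [_ ->|y]; rewrite /ball_at/= ?edistxx// => xy.
by apply/esym/edist_eq0/eqP; rewrite eq_le xy edist_nonneg.
Qed.

Lemma measurable_finite_set (A : set (d.-tuple R)) : finite_set A -> measurable A.
Proof.
move=> finA; rewrite (_ : A = \bigcup_(x in A) [set x]); last first.
  by apply/seteqP; split => [x Ax|x [y Ay ->]//]; exists x.
by apply: fin_bigcup_measurable => // x _; exact: measurable_set1_tuple.
Qed.

Section full_window.
Variables (W : set (d.-tuple R)) (mW : measurable W) (W1 : lebesgue d W = 1%E).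

Let Wn (n : nat) := W `&` [set x | enorm x <= n%:R].

Let mWn n : measurable (Wn n).
Proof.
apply: measurableI => //.
rewrite (_ : [set x | _] = ball_at [tuple 0 | _ < d] n%:R); first exact: measurable_ball_at.
by apply/seteqP; split => x /=; rewrite /ball_at/= edistC enorm_edist.
Qed.

Let Wn_nd : {homo Wn : n m / (n <= m)%N >-> (n <= m)%O}.
Proof.
move=> n m nm; apply/subsetPset => x [Wx xn]; split=> //=.
by apply: le_trans xn _; rewrite ler_nat.
Qed.

Let bigcup_Wn : \bigcup_n Wn n = W.
Proof.
apply/seteqP; split => [x [n _ []]//|x Wx].
exists (Num.truncn (enorm x)).+1 => //; split=> //=.
by apply: ltW; case/andP: (truncn_itv (sqrtr_ge0 _ : 0 <= enorm x)).
Qed.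

Let bigcup_setI (A : set (d.-tuple R)) : \bigcup_n (A `&` Wn n) = A `&` W.
Proof. by rewrite -setI_bigcupr bigcup_Wn. Qed.

(** Continuity from below of the counting measure; the sets involved are finite by local finiteness,
    hence measurable. *)
Lemma cvg_count_iso w : (fun n => count_iso (Wn n) w) @ \oo --> count_iso W w.
Proof.
rewrite /count_iso -bigcup_setI.
have mI n : measurable (isolated_pts r (eta w) `&` Wn n).
  apply: measurable_finite_set.
  apply: sub_finite_set (poisson_process_locally_finite eta_poisson w n%:R).
  by move=> x [[Sx _] [_ xn]].
apply: (@nondecreasing_cvg_mu _ _ _ (@counting (d.-tuple R) R)) => //.
- exact: bigcup_measurable.
- move=> n m nm; apply/subsetPset; apply: setIS; exact/subsetPset/Wn_nd.
Qed.

Lemma measurable_count_isoW : measurable_fun setT (count_iso W).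
Proof.
apply: (@emeasurable_fun_cvg _ _ R setT (fun n => count_iso (Wn n))).
  move=> n; apply: (@measurable_count_iso _ (mWn n) n%:R) => //.
  by move=> x [].
by move=> w _; exact: cvg_count_iso.
Qed.

(** W may be unbounded and contain infinitely many points, but as its mean number of points is t, it
    almost surely contains finitely many. Then a large ball holds them all and the counts in [Wn n]
    and W coincide. *)
Lemma cvg_prob_count_iso (A : set nat) :
  (fun n => fine (P (count_iso (Wn n) @^-1` nat_values A))) @ \oo -->
  fine (P (count_iso W @^-1` nat_values A)).
Proof.
have mC V : measurable_fun setT (count_iso V) ->
    measurable (count_iso V @^-1` nat_values A).
  by move=> mV; rewrite -[X in measurable X]setTI; apply: mV => //; exact: measurable_nat_values.
have mCn n : measurable_fun setT (count_iso (Wn n)).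
  by apply: (@measurable_count_iso _ (mWn n) n%:R) => // x [].
apply: fine_cvg; rewrite fineK; last by apply: fin_num_measure; apply: mC; exact: measurable_count_isoW.
pose D := num_points eta W @^-1` nat_values [set: nat].
apply: (@cvg_probability_near _ _ _ P D).
- by apply: (measurable_num_points eta_poisson) => //; exact: measurable_nat_values.
- rewrite /D (poisson_process_law eta_poisson)//.
    exact: (@probability_setT _ _ _ (poisson_prob (fine (t%:E * lebesgue d W)) 0%N)).
  by rewrite W1 mule1 ltry.
- by move=> n; exact: mC.
- by apply: mC; exact: measurable_count_isoW.
move=> w [k _ kW].
have finW : finite_set (eta w `&` W).
  by move: kW; rewrite /num_points /counting; case: ifPn => // /asboolP.
have /finite_seqP[s Ss] := finW.
have hs : \forall n \near \oo, forall x, x \in s -> enorm x <= n%:R.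
  apply: near_all_seq => x _; exact: nbhs_infty_ger.
near=> n.
have -> : (count_iso (Wn n) @^-1` nat_values A) w <-> nat_values A (count_iso (Wn n) w) by [].
suff -> : count_iso (Wn n) w = count_iso W w by [].
have hn : forall x, x \in s -> enorm x <= n%:R by near: n; exact: hs.
rewrite /count_iso; congr counting; apply/seteqP; split => [x [? []]//|x [[Sx xi] Wx]].
split=> //; split=> //=; apply: hn.
by have : [set` s] x by rewrite -Ss.
Unshelve. all: by end_near. Qed.

Local Notation vol B := (fine (lebesgue d B)).

Lemma cvg_volWn : (fun n => vol (Wn n)) @ \oo --> (1 : R).
Proof.
apply: fine_cvg; rewrite -W1 -bigcup_Wn.
apply: nondecreasing_cvg_mu => //; exact: bigcup_measurable.
Qed.

Lemma cvg_stein_limit (u b : nat -> R) (l : R) : u @ \oo --> (1 : R) -> b @ \oo --> l ->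
  (fun n => stein_limit (u n) (b n)) @ \oo --> l.
Proof.
move=> u1 bl; rewrite -[X in _ --> X](_ : stein_limit 1 l = l); last first.
  by rewrite /stein_limit mulr1 subrr normr0 mulr0 mul0r add0r mul1r.
apply: cvgD; last exact: cvgM.
apply: cvgMl; apply: cvgMr; apply: cvg_norm; apply: cvgB; first exact: cvg_cst.
exact: cvgMr.
Qed.

Lemma count_iso_poisson (A : set nat) :
  `|fine (P (count_iso W @^-1` nat_values A)) - poisson_mean lam (\1_A)| <= disturb_limit.
Proof.
have c2 : (fun n => stein_limit (vol (Wn n)) disturb_limit) @ \oo --> disturb_limit.
  exact: cvg_stein_limit cvg_volWn (cvg_cst _).
have c1 : (fun n => `|fine (P (count_iso (Wn n) @^-1` nat_values A)) - poisson_mean lam (\1_A)|) @ \oo -->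
    `|fine (P (count_iso W @^-1` nat_values A)) - poisson_mean lam (\1_A)|.
  by apply: cvg_norm; apply: cvgB; [exact: cvg_prob_count_iso|exact: cvg_cst].
apply: (ler_cvg_to c1 c2); near=> n.
by apply: (@count_iso_bounded _ (mWn n) n%:R) => // x [].
Unshelve. all: by end_near. Qed.

Lemma count_iso_void :
  `|fine (P (count_iso W @^-1` nat_values [set 0%N])) - expR (- lam)| <=
  disturb_limit * (lam^-1 + disturb_limit + 4 ^+ d * v * expR (- v)).
Proof.
have c2 : (fun n => stein_limit (vol (Wn n)) (void_limit (vol (Wn n)))) @ \oo -->
    disturb_limit * (lam^-1 + disturb_limit + 4 ^+ d * v * expR (- v)).
  apply: cvg_stein_limit; first exact: cvg_volWn.
  apply: cvgMr; apply: cvgD; last exact: cvg_cst.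
  apply: cvgD; first exact: cvg_cst.
  exact: cvg_stein_limit cvg_volWn (cvg_cst _).
have c1 : (fun n => `|fine (P (count_iso (Wn n) @^-1` nat_values [set 0%N])) - expR (- lam)|) @ \oo -->
    `|fine (P (count_iso W @^-1` nat_values [set 0%N])) - expR (- lam)|.
  by apply: cvg_norm; apply: cvgB; [exact: cvg_prob_count_iso|exact: cvg_cst].
apply: (ler_cvg_to c1 c2); near=> n.
by apply: (@count_iso_void_bounded _ (mWn n) n%:R) => // x [].
Unshelve. all: by end_near. Qed.

End full_window.

End limit_of_meshes.

(** * Exceedances of h and isolated points *)

Lemma esum1_counting (T : choiceType) (R : realType) (A : set T) :
  (\esum_(x in A) (1 : \bar R) = counting A)%E.
Proof.
have [finA|infA] := pselect (finite_set A).
  rewrite /counting asboolT// -[in LHS](fset_setK finA) esum_fset//.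
  rewrite fsbig_finite//= set_fsetK big_const_seq count_predT.
  by elim: (size _) => //= n ->; rewrite -EFinD nat1r.
rewrite /counting asboolF//; apply/eqyP => x x0.
have [n xn] : exists n : nat, x <= n%:R.
  by exists (Num.truncn x).+1; apply/ltW; case/andP: (truncn_itv (ltW x0)).
have [B BA Bn] := @infinite_set_fset _ A n infA.
apply: esum_ge; apply: ex_intro2; first exact: (conj (finite_fset B) BA).
rewrite fsbig_finite//= set_fsetK big_const_seq count_predT; move: Bn; set k := size _ => nk.
rewrite (_ : iter k _ _ = k%:R%:E); first by rewrite lee_fin (le_trans xn)// ler_nat.
by elim: (k) => //= j ->; rewrite -EFinD nat1r.
Qed.

(** The constant-sequence case of [cvg_probability_near]. *)
Lemma probability_eq_on d (T : measurableType d) (R : realType) (P : probability T R)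
    (D E E' : set T) : measurable D -> P D = 1%E -> measurable E -> measurable E' ->
  (forall w, D w -> E w <-> E' w) -> P E = P E'.
Proof.
move=> mD PD mE mE' EE'.
have := @cvg_probability_near _ _ _ P D (fun=> E) E' mD PD (fun=> mE) mE'.
move=> /(_ _)/wrap[w Dw|]; first by near=> n; exact: EE'.
by move=> /(cvg_unique _ (cvg_cst (P E))); apply.
Unshelve. all: by end_near. Qed.

Section nearest_neighbour_exceedance.
Context {R : realType} {d : nat} (d_gt0 : (0 < d)%N).
Variables (t : R) (t_gt0 : 0 < t).
Implicit Types (S W : set (d.-tuple R)) (x y : d.-tuple R) (r u : R).

Local Notation ball_mass := (@ball_mass R d t).

Let tk_gt0 : 0 < t * unit_ball_volume R d.
Proof. by rewrite mulr_gt0// unit_ball_volume_gt0. Qed.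

Lemma ball_mass_lt r s : 0 <= r -> 0 <= s -> (ball_mass r < ball_mass s) = (r < s).
Proof.
move=> r0 s0; rewrite /ball_mass !mulrA ltr_pM2l//.
by rewrite ltr_pXn2r ?nnegrE// gtn_eqF.
Qed.

Lemma radius_exists (v : R) : 0 < v -> exists2 r, 0 < r & ball_mass r = v.
Proof.
move=> v0; have a0 : 0 < v / (t * unit_ball_volume R d) by rewrite divr_gt0.
exists ((v / (t * unit_ball_volume R d)) `^ (d%:R^-1)); first exact: powR_gt0.
rewrite /ball_mass -powR_mulrn ?powR_ge0// -powRrM mulVf ?pnatr_eq0 -?lt0n//.
rewrite powRr1 ?(ltW a0)//; field.
by rewrite !gt_eqF// unit_ball_volume_gt0.
Qed.

(** As h is an infimum, a strict bound on it needs a uniform gap. Local finiteness provides one: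
    finitely many points lie within r + 1 of x, and all others are farther away. *)
Lemma isolated_gap S x r : locally_finite S ->
  (forall y, S y -> y <> x -> r < edist x y) ->
  exists2 s, r < s & forall y, S y -> y <> x -> s <= edist x y.
Proof.
move=> lfS xiso; have /finite_seqP[l Sl] := lfS (enorm x + (r + 1)).
have : exists2 s, r < s & forall y, y \in l -> y <> x -> s <= edist x y.
  have : forall y, y \in l -> S y.
    by move=> y yl; have : [set` l] y by []; rewrite -Sl => -[].
  elim: l {Sl} => [_|y l IH lS]; first by exists (r + 1) => //; rewrite ltrDl.
  have [|s rs hs] := IH; first by move=> z zl; apply: lS; rewrite inE zl orbT.
  have [yx|/eqP yx] := eqVneq y x.
    by exists s => // z; rewrite inE => /orP[/eqP ->//|]; exact: hs.
  exists (Num.min s (edist x y)).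
    by rewrite lt_min rs xiso//; apply: lS; exact: mem_head.
  move=> z; rewrite inE ge_min => /orP[/eqP ->|zl zx]; first by rewrite lexx orbT.
  by rewrite hs.
move=> [s rs hs]; exists (Num.min s (r + 1)); first by rewrite lt_min rs/= ltrDl ltr01.
move=> y Sy yx; rewrite ge_min; have [yl|yl] := boolP (y \in l); first by rewrite hs.
apply/orP; right; rewrite leNgt; apply/negP => xy; move/negP : yl; apply.
suff : [set` l] y by [].
rewrite -Sl; split=> //=; apply: le_trans (enorm_le_edist x y) _.
by rewrite lerD2l ltW.
Qed.

Lemma lt_nn_h S x r u : locally_finite S -> 0 <= r -> ball_mass r = u + ln t ->
  (u%:E < nn_h t x S)%E <-> (forall y, S y -> y <> x -> r < edist x y).
Proof.
move=> lfS r0 ru; rewrite /nn_h lteBrDr// -EFinD -ru; split=> [h y Sy yx|xiso].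
  rewrite -ball_mass_lt ?edist_nonneg// -lte_fin; apply: lt_le_trans h _.
  by apply: ereal_inf_lbound; exists y => //; rewrite /ball_mass mulrA.
have [s rs hs] := isolated_gap lfS xiso.
apply: (@lt_le_trans _ _ (ball_mass s)%:E).
  by rewrite lte_fin ball_mass_lt// (le_trans r0)// ltW.
apply: le_ereal_inf_tmp => _ [y [Sy yx] <-]; rewrite lee_fin /ball_mass mulrA ler_pM2l//.
by rewrite lerXn2r ?nnegrE ?edist_nonneg ?hs// (le_trans r0)// ltW.
Qed.

Lemma nn_h_fin S x y : S y -> y <> x -> nn_h t x S \is a fin_num.
Proof.
move=> Sy yx; rewrite /nn_h fin_numB andbT ge0_fin_numE.
  apply: le_lt_trans (ltry (t * unit_ball_volume R d * edist x y ^+ d)).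
  by apply: ereal_inf_lbound; exists y.
apply: le_ereal_inf_tmp => _ [z _ <-]; rewrite lee_fin.
by rewrite mulr_ge0 ?exprn_ge0 ?edist_nonneg// ltW.
Qed.

Lemma xi_count S W r u : locally_finite S -> 0 <= r -> ball_mass r = u + ln t ->
  (forall x, S x -> exists2 y, S y & y <> x) ->
  xi t W S (EFin @` `]u, +oo[) = counting (isolated_pts r S `&` W).
Proof.
move=> lfS r0 ru two; rewrite -esum1_counting /xi.
rewrite esum_mkcond [RHS]esum_mkcond; apply: eq_esum => x _.
have [[Sx Wx]|nSW] := pselect ((S `&` W) x); last first.
  rewrite !memNset// => -[[Sx _] Wx]; exact: nSW.
rewrite mem_set//; have [y Sy yx] := two x Sx.
have hfin := nn_h_fin Sy yx.
have hE := lt_nn_h x lfS r0 ru.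
rewrite diracE; have [xiso|xniso] := pselect (forall y, S y -> y <> x -> r < edist x y).
  rewrite !mem_set//.
  exists (fine (nn_h t x S)); last by rewrite fineK.
  by rewrite /= in_itv/= andbT -lte_fin fineK//; apply/hE.
rewrite !memNset//; first by move=> [[_ ?] _].
move=> [z /= ]; rewrite in_itv/= andbT => uz zE; apply: xniso; apply/hE.
by rewrite -zE lte_fin.
Qed.

Lemma xi_singleton x W u : xi t W [set x] (EFin @` `]u, +oo[) = 0%E.
Proof.
rewrite /xi esum1// => y [/= -> _]; rewrite diracE memNset// => -[z _].
rewrite /nn_h (_ : [set _ | _ in _] = set0) ?ereal_inf0//.
by apply/seteqP; split => // e [z' []].
Qed.

Lemma lt_T_max S W r u : locally_finite S -> 0 <= r -> ball_mass r = u + ln t ->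
  (u%:E < T_max t W S)%E <-> counting (isolated_pts r S `&` W) <> 0%E :> \bar R.
Proof.
move=> lfS r0 ru; rewrite counting_eq0; split=> [/ereal_sup_gt[_ [x [Sx Wx] <-]]|].
  move=> /(lt_nn_h x lfS r0 ru) xiso /seteqP[+ _] => /(_ x); apply.
  by split.
move=> /eqP/set0P[x [[Sx xiso] Wx]]; apply: (@lt_le_trans _ _ (nn_h t x S)).
  exact/(lt_nn_h x lfS r0 ru).
by apply: ereal_sup_ubound; exists x.
Qed.

(** The degenerate radius 0: distinct points are at positive distance, so h > -ln t at every
    point. *)
Lemma lt_T_max_low S W u : locally_finite S -> u <= - ln t ->
  (u%:E < T_max t W S)%E <-> S `&` W !=set0.
Proof.
move=> lfS ut; split=> [/ereal_sup_gt[_ [x [Sx Wx] <-]] _|[x [Sx Wx]]]; first by exists x.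
apply: (@le_lt_trans _ _ (- ln t)%:E); first by rewrite lee_fin.
apply: (@lt_le_trans _ _ (nn_h t x S)); last by apply: ereal_sup_ubound; exists x.
apply/(@lt_nn_h S x 0 _ lfS (lexx 0)).
  by rewrite addNr /ball_mass expr0n gtn_eqF// !mulr0.
move=> y Sy yx; rewrite lt_neqAle edist_nonneg andbT; apply/eqP => /esym/edist_eq0 xy.
exact: yx.
Qed.

End nearest_neighbour_exceedance.

(** * The Poisson and Gumbel bounds *)

Section numeric_bounds.
Context {R : realType}.
Implicit Types (a b s t u v L : R).

(** The function v exp(-c v) decreases beyond 1/c. By exp(x) >= 1 + x it suffices that (c L - 1)(v -
    L) >= 0. *)
Lemma mul_expRN_decr c L v : 0 < c -> 1 <= c * L -> L <= v ->
  v * expR (- (c * v)) <= L * expR (- (c * L)).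
Proof.
move=> c0 cL Lv; have L0 : 0 < L by rewrite -(pmulr_rgt0 _ c0); lra.
rewrite (_ : - (c * L) = - (c * v) + c * (v - L)); last by ring.
rewrite expRD mulrCA [leLHS]mulrC ler_pM2l ?expR_gt0//.
have := expR_ge1Dx (c * (v - L)); move: (expR _) => e he.
apply: (@le_trans _ _ (L * (1 + c * (v - L)))); last by rewrite ler_pM2l.
by have : 0 <= (c * L - 1) * (v - L); [rewrite mulr_ge0; lra|lra].
Qed.

(** To be read with a = 2^d, b = exp(-u/2), so that b^2 = lam, L = log t, s = sqrt t, v = u + L and
    e the limiting disturbance. The hypothesis b^2 <= L/2 is u >= -log(L/2). *)
Lemma void_product_bound a b L s v e : 1 <= a -> 1 <= b -> b ^+ 2 <= L / 2 ->
  (L / 2) ^+ 2 <= s -> 0 <= v <= L ->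
  0 <= e <= v * (b ^+ 2 / s ^+ 2) + a * v * (b / s) ->
  e * ((b ^+ 2)^-1 + e + a ^+ 2 * v * (b ^+ 2 / s ^+ 2)) <=
  (2 * a ^+ 3 + 4 * a ^+ 2 + 5 * a + 3) * (L / s).
Proof.
move=> a1 b1 bL Ls /andP[v0 vL] /andP[e0 he].
pose l := L / 2.
have LE : L = 2 * l by rewrite /l; field.
rewrite -/l in bL Ls.
have bb : b <= b ^+ 2 by rewrite expr2 ler_peMl//; lra.
have l1 : 1 <= l by lra.
have ll : l <= l ^+ 2 by rewrite expr2 ler_peMl//; lra.
have s1 : 1 <= s by lra.
have bs : b <= s by lra.
have ls : l <= s by lra.
have s0 : 0 < s by lra.
have b0 : 0 < b by lra.
have x0 : 0 <= s^-1 by rewrite invr_ge0 ltW.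
have bs1 : b / s <= 1 by rewrite ler_pdivrMr// mul1r.
have bs0 : 0 <= b / s by rewrite divr_ge0 ?ltW.
pose X := (1 + a) * b.
have eX : e <= L / s * X.
  apply: le_trans he _.
  have -> : v * (b ^+ 2 / s ^+ 2) + a * v * (b / s) = v * (b / s * (b / s + a)).
    by field; rewrite gt_eqF.
  have -> : L / s * X = L * (b / s * (1 + a)) by rewrite /X; field; rewrite gt_eqF.
  apply: ler_pM => //; first by rewrite mulr_ge0//; lra.
  by rewrite ler_wpM2l//; lra.
have Ls0 : 0 <= L / s by rewrite mulr_ge0//; lra.
have bsq0 : 0 <= b ^+ 2 / s ^+ 2 by rewrite divr_ge0 ?exprn_ge0 ?ltW.
apply: (@le_trans _ _ (L / s * X * ((b ^+ 2)^-1 + L / s * X + a ^+ 2 * L * (b ^+ 2 / s ^+ 2)))).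
  apply: ler_pM => //.
    rewrite !addr_ge0 ?invr_ge0 ?exprn_ge0 ?(ltW b0)//.
    apply: mulr_ge0 => //; apply: mulr_ge0 => //; apply: exprn_ge0; lra.
  apply: lerD; first by rewrite lerD2l.
  by rewrite ler_wpM2r// ler_wpM2l ?exprn_ge0//; lra.
rewrite -mulrA [leRHS]mulrC ler_wpM2l//.
have i1 : b^-1 <= 1 by rewrite invf_le1//; lra.
(* The right sides of p1, p2 and p3 add up to the polynomial in a; they rest on b >= 1, b^2 <= l and
   l^2 <= s. *)
have p1 : X * (b ^+ 2)^-1 <= 1 + a.
  rewrite (_ : X * _ = (1 + a) * b^-1); last by rewrite /X; field; rewrite gt_eqF.
  by rewrite ler_piMr//; lra.
have p2 : X * (L / s * X) <= 2 * (1 + a) ^+ 2.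
  rewrite (_ : _ * _ = (1 + a) ^+ 2 * (L * b ^+ 2 / s)); last by rewrite /X; ring.
  rewrite mulrC ler_wpM2r ?exprn_ge0//; first lra.
  rewrite ler_pdivrMr//.
  apply: (@le_trans _ _ (2 * l * l)); last by rewrite -mulrA -expr2 ler_wpM2l.
  by rewrite LE ler_wpM2l//; lra.
have p3 : X * (a ^+ 2 * L * (b ^+ 2 / s ^+ 2)) <= 2 * (1 + a) * a ^+ 2.
  rewrite (_ : _ * _ = (1 + a) * a ^+ 2 * (L * b * b ^+ 2 / s ^+ 2)); last by rewrite /X; ring.
  rewrite (_ : 2 * _ * _ = (1 + a) * a ^+ 2 * 2); last by ring.
  rewrite ler_wpM2l//; first by rewrite mulr_ge0 ?exprn_ge0//; lra.
  rewrite ler_pdivrMr ?exprn_gt0//.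
  rewrite (_ : L * b * b ^+ 2 = 2 * (l * b * b ^+ 2)); last by rewrite LE; ring.
  rewrite ler_wpM2l//.
  apply: (@le_trans _ _ (s * s)); last by rewrite expr2.
  apply: ler_pM.
  - by rewrite mulr_ge0//; lra.
  - by rewrite exprn_ge0// ltW.
  - by apply: le_trans Ls; rewrite expr2 ler_wpM2l//; lra.
  - by lra.
rewrite !mulrDr.
have -> : 2 * a ^+ 3 + 4 * a ^+ 2 + 5 * a + 3 =
  (1 + a) + 2 * (1 + a) ^+ 2 + 2 * (1 + a) * a ^+ 2 by ring.
by rewrite lerD// lerD.
Qed.

End numeric_bounds.

Lemma natural_log_sqrt_bounds (R : realType) (t : R) : expR 2 < t ->
  let s := Num.sqrt t in let L := ln t in
  [/\ 0 < s, s ^+ 2 = t, 2 < L, (L / 2) ^+ 2 <= s & expR (- (L / 2)) = s^-1].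
Proof.
move=> t2 s L; have t0 : 0 < t by exact: lt_trans (expR_gt0 2) t2.
have L2 : 2 < L by rewrite -ltr_expR lnK ?posrE.
have sE : s = expR (L / 2).
  apply/eqP; rewrite -(@eqrXn2 _ 2)// ?sqrtr_ge0 ?expR_ge0//.
  rewrite sqr_sqrtr ?ltW// -expRM_natl (_ : 2%:R * _ = L) ?lnK ?posrE//.
  by field.
split; rewrite ?sqrtr_gt0 ?sqr_sqrtr ?(ltW t0)//; last by rewrite expRN sE.
rewrite sE; clear sE; clearbody L.
rewrite (_ : L / 2 = 2%:R * (L / 4)); last by field.
have L0 : 0 <= 2%:R * (L / 4) by lra.
rewrite expRM_natl ler_pXn2r ?nnegrE ?expR_ge0//.
have e2 : 2 <= expR (1 : R) by apply: le_trans (expR_ge1Dx _); lra.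
(* With x = L/4, exp(x) = e exp(x - 1) >= 2 x, because e >= 2 and exp(x - 1) >= x; squaring gives
   the claim. *)
have h := expR_ge1Dx (L / 4 - 1).
have : 2 * expR (L / 4 - 1) <= expR 1 * expR (L / 4 - 1).
  by rewrite ler_pM2r ?expR_gt0.
rewrite -expRD (_ : 1 + (L / 4 - 1) = L / 4); last by ring.
move: (expR (L / 4)) (expR (L / 4 - 1)) h => e f; lra.
Qed.

Section exceedances.
Context {R : realType} {d : nat} (d_gt0 : (0 < d)%N).
Variables (W : set (d.-tuple R)) (mW : measurable W) (W1 : lebesgue d W = 1%E).
Variables (t : R) (t_gt : expR 2 < t).
Context {dO : measure_display} {Om : measurableType dO}.
Variables (P : probability Om R) (eta : Om -> set (d.-tuple R)).
Hypothesis eta_poisson : is_poisson_process P (fun B => (t%:E * lebesgue d B)%E) eta.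

Let t_gt0 : 0 < t. Proof. exact: lt_trans (expR_gt0 2) t_gt. Qed.

Let lfS w : locally_finite (eta w).
Proof. exact: poisson_process_locally_finite eta_poisson w. Qed.

(** Infinite total mass makes eta almost surely infinite, which rules out a lone point without
    nearest neighbour. *)
Lemma lebesgue_full : lebesgue d [set: d.-tuple R] = +oo%E.
Proof.
have := @lebesgue_box R d (fun=> setT) (fun=> measurableT).
rewrite (_ : [set x | _] = setT); last by apply/seteqP; split.
move=> ->; have TE : @lebesgue_measure R setT = +oo%E.
  by rewrite -set_itvE lebesgue_measure_itv.
case: d d_gt0 => // n _; elim: n => [|n IH]; first by rewrite big_ord1 TE.
by rewrite big_ord_recl IH TE.
Qed.

Let infinite_points := num_points eta setT @^-1` [set +oo%E].

Let measurable_infinite_points : measurable infinite_points.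
Proof. by apply: (measurable_num_points eta_poisson) => //; exact: emeasurable_set1. Qed.

Let prob_infinite_points : P infinite_points = 1%E.
Proof.
apply: (poisson_process_law_infinite eta_poisson) => //.
by rewrite lebesgue_full gt0_muley// lte_fin.
Qed.

Lemma two_points (S : set (d.-tuple R)) : counting S <> 1%E :> \bar R ->
  forall x, S x -> exists2 y, S y & y <> x.
Proof.
move=> S1 x Sx; apply: contrapT => h; apply: S1.
have -> : S = [set x].
  apply/seteqP; split => [y Sy|_ ->//]; apply: contrapT => yx.
  by apply: h; exists y.
by rewrite /counting asboolT// fset_set1 finmap.cardfs1.
Qed.

Lemma counting1_singleton (S : set (d.-tuple R)) : counting S = 1%E :> \bar R ->
  exists x, S = [set x].
Proof.
rewrite /counting; case: ifPn => // /asboolP finS [] /eqP.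
rewrite (eqr_nat _ _ 1) => /finmap.cardfs1P[x Sx]; exists x.
by rewrite -(fset_setK finS) Sx set_fset1.
Qed.

Variables (u r : R) (ut : - ln t < u) (r_gt0 : 0 < r) (ru : @ball_mass R d t r = u + ln t).

Let X w := xi t W (eta w) (EFin @` `]u, +oo[).

Let X_count w : num_points eta setT w <> 1%E -> X w = count_iso eta r W w.
Proof.
rewrite /num_points setIT => S1; apply: (xi_count d_gt0 t_gt0 W (lfS w) (ltW r_gt0) ru).
exact: two_points.
Qed.

Let X_singleton w : num_points eta setT w = 1%E -> X w = 0%E.
Proof.
rewrite /num_points setIT => /counting1_singleton[x Sx]; rewrite /X Sx.
exact: xi_singleton.
Qed.

Let measurable_count (A : set (\bar R)) : measurable A -> measurable (count_iso eta r W @^-1` A).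
Proof.
move=> mA; rewrite -[X in measurable X]setTI.
exact: (measurable_count_isoW d_gt0 eta_poisson r_gt0 mW).
Qed.

Lemma measurable_xi (A : set (\bar R)) : measurable A -> measurable (X @^-1` A).
Proof.
move=> mA; pose one := num_points eta setT @^-1` [set 1%E].
have m1 : measurable one.
  by apply: (measurable_num_points eta_poisson) => //; exact: emeasurable_set1.
rewrite (_ : X @^-1` A = (count_iso eta r W @^-1` A `&` ~` one) `|` (one `&` [set w | A 0%E])).
  apply: measurableU.
    by apply: measurableI; [exact: measurable_count|exact: measurableC].
  apply: measurableI => //; have [A0|A0] := pselect (A 0%E).
    by rewrite (_ : [set _ | _] = setT)//; apply/seteqP; split.
  by rewrite (_ : [set _ | _] = set0)//; apply/seteqP; split.
apply/seteqP; split => w /=.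
  have [w1|w1] := pselect (num_points eta setT w = 1%E).
    by rewrite X_singleton// => A0; right.
  by rewrite X_count// => Aw; left.
by move=> [[Aw w1]|[w1 A0]]; [rewrite X_count|rewrite X_singleton].
Qed.

(* If eta has exactly one point, h is +oo there, which xi does not count in
   ]u, +oo[ although the point is isolated; but eta is almost surely infinite. *)
Lemma prob_xi (A : set (\bar R)) : measurable A ->
  P (X @^-1` A) = P (count_iso eta r W @^-1` A).
Proof.
move=> mA; apply: (probability_eq_on measurable_infinite_points prob_infinite_points).
- exact: measurable_xi.
- exact: measurable_count.
by move=> w wi; rewrite /= X_count// wi.
Qed.

Lemma lam_radius : t * expR (- @ball_mass R d t r) = expR (- u).
Proof.
rewrite ru opprD expRD -lnV ?posrE// lnK ?posrE ?invr_gt0//.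
by rewrite mulrCA mulfV ?gt_eqF// mulr1.
Qed.

Lemma disturb_limitE : @disturb_limit R d t r =
  2 ^+ d * ((u + ln t) / (expR (u / 2) * Num.sqrt t)) + (u + ln t) / (expR u * t).
Proof.
have [s0 st _ _ es] := natural_log_sqrt_bounds t_gt.
rewrite /disturb_limit ru addrC; congr (_ + _).
  rewrite -mulrA; congr (_ * (_ * _)); rewrite invfM -expRN -es -expRD.
  by congr expR; field.
congr (_ * _); rewrite invfM -expRN -{2}(lnK (_ : t \is Num.pos)) ?posrE//.
by rewrite -expRN -expRD; congr expR; ring.
Qed.

Lemma prob_xi_poisson (A : set nat) :
  `|fine (P (X @^-1` nat_values A)) - poisson_mean (expR (- u)) (\1_A)| <=
  @disturb_limit R d t r.
Proof.
rewrite prob_xi; last exact: measurable_nat_values.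
rewrite -lam_radius.
exact: count_iso_poisson.
Qed.

Let exceed := [set w | (u%:E < T_max t W (eta w))%E].

Let exceedC : ~` exceed = count_iso eta r W @^-1` nat_values [set 0%N].
Proof.
rewrite nat_values0; apply/seteqP; split => w; rewrite /exceed /=;
  have h := lt_T_max d_gt0 t_gt0 W (lfS w) (ltW r_gt0) ru.
  by move=> /h /contrapT.
by move=> w0 /h; apply.
Qed.

Lemma measurable_not_exceed : measurable (~` exceed).
Proof. by rewrite exceedC; apply: measurable_count; exact: measurable_nat_values. Qed.

Lemma prob_not_exceed_tv : `|fine (P (~` exceed)) - expR (- expR (- u))| <= @disturb_limit R d t r.
Proof.
rewrite exceedC -lam_radius -(poisson_mean_ind0 (mulr_gt0 t_gt0 (expR_gt0 _))).
have -> : ind0 = \1_[set 0%N] :> (nat -> R).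
  by apply/funext => k; rewrite indicE /ind0; case: eqP => k0; [rewrite mem_set|rewrite memNset].
exact: count_iso_poisson.
Qed.

Lemma prob_not_exceed_void : `|fine (P (~` exceed)) - expR (- expR (- u))| <=
  @disturb_limit R d t r * ((expR (- u))^-1 + @disturb_limit R d t r +
    4 ^+ d * (u + ln t) * (expR (- u) / t)).
Proof.
rewrite exceedC; have := count_iso_void d_gt0 t_gt0 eta_poisson r_gt0 mW W1.
rewrite lam_radius (_ : expR (- u) / t = expR (- @ball_mass R d t r)); last first.
  by rewrite -lam_radius mulrAC mulfV ?mul1r// gt_eqF.
by rewrite ru.
Qed.

End exceedances.

(** * The Kolmogorov bound in the three ranges of u *)

Section kolmogorov.
Context {R : realType} {d : nat} (d_gt0 : (0 < d)%N).
Variables (W : set (d.-tuple R)) (mW : measurable W) (W1 : lebesgue d W = 1%E).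
Variables (t : R) (t_gt : expR 2 < t).
Context {dO : measure_display} {Om : measurableType dO}.
Variables (P : probability Om R) (eta : Om -> set (d.-tuple R)).
Hypothesis eta_poisson : is_poisson_process P (fun B => (t%:E * lebesgue d B)%E) eta.

Let t_gt0 : 0 < t. Proof. exact: lt_trans (expR_gt0 2) t_gt. Qed.

Let exceed u := [set w | (u%:E < T_max t W (eta w))%E].
Let p u := fine (P (~` exceed u)).

Local Notation L := (ln t).
Local Notation s := (Num.sqrt t).
Local Notation a := (2 ^+ d : R).
Local Notation C := (2 ^+ (d + 2) * (4 ^+ d + 2 ^+ d + 2) + 1 : R).

Let radius u : - L < u -> exists2 r, 0 < r & @ball_mass R d t r = u + L.
Proof. by move=> uL; apply: radius_exists => //; rewrite -ltrBlDr sub0r. Qed.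

Lemma measurable_exceed u : measurable (exceed u).
Proof.
rewrite -[exceed u]setCK; apply: measurableC.
have [uL|uL] := ltP (- L) u.
  have [r r0 ru] := radius uL.
  exact: (measurable_not_exceed d_gt0 mW t_gt eta_poisson r0 ru).
rewrite (_ : ~` exceed u = num_points eta W @^-1` [set 0%E]).
  by apply: (measurable_num_points eta_poisson) => //; exact: emeasurable_set1.
have lfS w := poisson_process_locally_finite eta_poisson w.
apply/seteqP; split => w; rewrite /exceed /= num_points_eq0.
  move=> h; apply/eqP/negPn; apply/negP => /set0P ne; apply: h.
  by apply/(lt_T_max_low d_gt0 t_gt0).
by move=> e /(lt_T_max_low d_gt0 t_gt0 _ (lfS w) uL); rewrite e => -[].
Qed.

Let p_ge0 u : 0 <= p u. Proof. exact: fine_ge0. Qed.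

Let p_nd u u' : u <= u' -> p u <= p u'.
Proof.
move=> uu'; have mC v : measurable (~` exceed v) by apply: measurableC; exact: measurable_exceed.
apply: fine_le; rewrite ?fin_num_measure//; apply: le_measure; rewrite ?inE//.
by apply: subsetC => w /=; apply: le_lt_trans; rewrite lee_fin.
Qed.

Let a_ge1 : 1 <= a. Proof. by rewrite exprn_ege1// ler1n. Qed.

Let CE : C = 4 * a ^+ 3 + 4 * a ^+ 2 + 8 * a + 1.
Proof.
have -> : 4 ^+ d = a ^+ 2 :> R by rewrite -exprM mulnC exprM; congr (_ ^+ d); ring.
by rewrite exprD; ring.
Qed.

(** For u >= 0 both terms of the disturbance are largest at u = 0, by [mul_expRN_decr] with c = 1
    and c = 1/2; the latter needs L >= 2, supplied by t > e^2. The result is at most (1 + a) L /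
    s. *)
Let low_bound u : 0 <= u -> `|p u - expR (- expR (- u))| <= C * (L / s).
Proof.
move=> u0; have [s0 st L2 Ls es] := natural_log_sqrt_bounds t_gt.
have uL : - L < u by lra.
have [r r0 ru] := radius uL.
apply: le_trans (prob_not_exceed_tv d_gt0 mW W1 t_gt eta_poisson r0 ru) _.
rewrite /disturb_limit ru.
have Lv : L <= u + L by rewrite lerDr.
have h1 : (u + L) * expR (- (u + L)) <= L * expR (- L).
  by have := @mul_expRN_decr _ 1 L (u + L) ltr01; rewrite !mul1r; apply => //; lra.
have h2 : (u + L) * expR (- ((u + L) / 2)) <= L * expR (- (L / 2)).
  have := @mul_expRN_decr _ (2^-1) L (u + L); rewrite ![2^-1 * _]mulrC; apply => //; lra.
have h3 : expR (- L) <= expR (- (L / 2)) by rewrite ler_expR; lra.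
rewrite CE -es -[2 ^+ d * _ * _]mulrA.
have a3 : 0 <= a ^+ 3 by rewrite exprn_ge0//; lra.
have a2 : 0 <= a ^+ 2 by rewrite exprn_ge0//; lra.
have e0 : 0 <= L * expR (- (L / 2)) by rewrite mulr_ge0 ?expR_ge0//; lra.
have h4 : L * expR (- L) <= L * expR (- (L / 2)) by rewrite ler_wpM2l//; lra.
move: e0 h1 h2 h4; set y := L * expR (- (L / 2)) => e0 h1 h2 h4.
apply: (@le_trans _ _ ((1 + a) * y)).
  rewrite [leRHS]mulrDl mul1r; apply: lerD; first exact: le_trans h4.
  by rewrite ler_wpM2l//; lra.
by rewrite ler_wpM2r//; move: a_ge1 a2 a3; lra.
Qed.

Let K := 2 * a ^+ 3 + 4 * a ^+ 2 + 5 * a + 3.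

Let middle_bound u : u <= 0 -> - ln (L / 2) <= u ->
  `|p u - expR (- expR (- u))| <= K * (L / s).
Proof.
move=> u0 uL2; have [s0 st L2 Ls es] := natural_log_sqrt_bounds t_gt.
have L20 : 0 < L / 2 by rewrite divr_gt0//; lra.
have uL : - L < u.
  apply: lt_le_trans uL2; rewrite ltrN2.
  by have := ln_sublinear L20; lra.
have [r r0 ru] := radius uL.
apply: le_trans (prob_not_exceed_void d_gt0 mW W1 t_gt eta_poisson r0 ru) _.
pose b := expR (- (u / 2)).
have bE : b ^+ 2 = expR (- u).
  by rewrite -expRM_natl; congr expR; field.
have e1 : expR (- (u + L)) = b ^+ 2 / s ^+ 2.
  rewrite bE st opprD expRD; congr (_ * _).
  by rewrite expRN lnK ?posrE.
have e2 : expR (- ((u + L) / 2)) = b / s.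
  by rewrite -es -expRD; congr expR; field.
have v0 : 0 <= u + L by lra.
have -> : 4 ^+ d = a ^+ 2 :> R by rewrite -exprM mulnC exprM; congr (_ ^+ d); ring.
rewrite -bE (_ : b ^+ 2 / t = b ^+ 2 / s ^+ 2); last by rewrite st.
apply: void_product_bound => //.
- by have := expR_ge1Dx (- (u / 2)); rewrite -/b; apply: le_trans; lra.
- by rewrite bE -[leRHS]lnK ?posrE// ler_expR; lra.
- by apply/andP; split; lra.
apply/andP; split.
  rewrite /disturb_limit ru; apply: addr_ge0; apply: mulr_ge0; rewrite ?expR_ge0//.
  by apply: mulr_ge0 => //; lra.
by rewrite /disturb_limit ru e1 e2.
Qed.

Lemma gumbel_bound u : `|p u - expR (- expR (- u))| <= C * (L / s).
Proof.
have [s0 st L2 Ls es] := natural_log_sqrt_bounds t_gt.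
have Ls0 : 0 <= L / s by rewrite mulr_ge0 ?invr_ge0 ?(ltW s0)//; lra.
have a3 : 0 <= a ^+ 3 by rewrite exprn_ge0//; lra.
have aa : a <= a ^+ 3 by rewrite exprS ler_peMr ?exprn_ege1//; lra.
have KC : K + 2^-1 <= C by rewrite CE /K; move: a_ge1 aa a3; lra.
have KL : K * (L / s) <= C * (L / s) by rewrite ler_wpM2r//; lra.
have [u0|u0] := leP 0 u; first exact: low_bound.
have [uL|uL] := leP (- ln (L / 2)) u.
  by apply: le_trans (middle_bound (ltW u0) uL) _.
have L21 : 1 <= L / 2 by lra.
have L20 : 0 < L / 2 by lra.
(* At the cut the Gumbel probability is exp(-L/2) = 1/s <= (L/s)/2, so p there is at most (K + 1/2)
   L/s <= C L/s. By monotonicity both probabilities at u lie between 0 and C L/s, and so does their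
   distance. *)
have := middle_bound _ (lexx (- ln (L / 2))).
rewrite oppr_le0 ln_ge0// opprK lnK ?posrE// => /(_ isT).
rewrite es => hm.
have h1 : p u <= p (- ln (L / 2)) by apply: p_nd; exact: ltW.
have h2 : expR (- expR (- u)) <= s^-1.
  rewrite -es ler_expR lerN2 -{1}(lnK (_ : L / 2 \is Num.pos)) ?posrE// ler_expR.
  by rewrite lerNr ltW.
have h3 : s^-1 <= 2^-1 * (L / s).
  rewrite mulrA -[leLHS]mul1r ler_pM2r ?invr_gt0//; lra.
have h4 := expR_ge0 (- expR (- u)); have h5 := p_ge0 u.
have h6 : p (- ln (L / 2)) <= C * (L / s).
  have : K * (L / s) + 2^-1 * (L / s) <= C * (L / s) by rewrite -mulrDl ler_wpM2r.
  by move: hm; rewrite ler_norml => /andP[_]; lra.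
have h7 : s^-1 <= C * (L / s).
  apply: le_trans h3 _; rewrite ler_wpM2r//.
  by move: KC; rewrite /K; have : 0 <= a ^+ 2 by [rewrite exprn_ge0//; lra]; move: a_ge1 a3; lra.
by rewrite ler_norml; apply/andP; split; lra.
Qed.

Lemma prob_exceed u : P (exceed u) = (1 - p u)%:E.
Proof.
have mC : measurable (~` exceed u) by apply: measurableC; exact: measurable_exceed.
rewrite -[exceed u in LHS]setCK probability_setC// EFinB; congr (_ - _)%E.
by rewrite fineK// fin_num_measure.
Qed.

End kolmogorov.

Theorem theorem3p15 (R : realType) (d : nat) (d_gt0 : (0 < d)%N)
    (W : set (d.-tuple R)) (mW : measurable W) (W1 : lebesgue d W = 1%E)
    (t : R) (t_gt : expR 2 < t)
    (dO : measure_display) (Om : measurableType dO) (P : probability Om R)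
    (eta : Om -> set (d.-tuple R))
    (eta_poisson :
      is_poisson_process P (fun B => (t%:E * lebesgue d B)%E) eta) :
  (forall (u : R), - ln t < u ->
   forall (dZ : measure_display) (OmZ : measurableType dZ)
     (PZ : probability OmZ R) (Z : {RV PZ >-> nat}),
   poisson_distributed (expR (- u)) Z ->
   (dTV P (fun w => xi t W (eta w) (EFin @` `]u, +oo[))
       PZ (fun w => (Z w)%:R%:E)
    <= (2 ^+ d * ((u + ln t) / (expR (u / 2) * Num.sqrt t))
        + (u + ln t) / (expR u * t))%:E)%E)
  /\
  (forall (dY : measure_display) (OmY : measurableType dY)
     (PY : probability OmY R) (Y : {RV PY >-> R}),
   standard_gumbel Y ->
   (dK P (fun w => T_max t W (eta w)) PY (fun w => (Y w)%:E)
    <= ((2 ^+ (d + 2) * (4 ^+ d + 2 ^+ d + 2) + 1) * (ln t / Num.sqrt t))%:E)%E).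
Proof.
have t0 : 0 < t by exact: lt_trans (expR_gt0 2) t_gt.
split=> [u ut dZ OmZ PZ Z ZP|dY OmY PY Y Ygumbel].
  have [r r0 ru] : exists2 r, 0 < r & @ball_mass R d t r = u + ln t.
    by apply: radius_exists => //; rewrite -ltrBlDr sub0r.
  apply: ge_ereal_sup => _ [A _ <-].
  have -> : PZ ((fun w => (Z w)%:R%:E : \bar R) @^-1` nat_values A) =
      (poisson_mean (expR (- u)) (\1_A))%:E.
    rewrite poisson_mean_indic ?expR_gt0// -ZP /distribution /pushforward; congr (PZ _).
    by apply/seteqP; split => w /=; rewrite nat_valuesP.
  have mA := @measurable_nat_values R A.
  rewrite -[X in (X - _)%E]fineK; last first.
    by apply: fin_num_measure; exact: (measurable_xi d_gt0 mW t_gt eta_poisson r0 ru mA).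
  rewrite -EFinB abse_EFin lee_fin -(disturb_limitE t_gt ru).
  exact: (prob_xi_poisson d_gt0 mW W1 t_gt eta_poisson r0 ru).
apply: ge_ereal_sup => _ [u _ <-].
rewrite (prob_exceed d_gt0 mW t_gt eta_poisson).
have -> : PY [set w | (u%:E < (Y w)%:E)%E] = (1 - expR (- expR (- u)))%:E.
  rewrite (_ : [set w | _] = ~` (Y @^-1` `]-oo, u]%classic)); last first.
    apply/seteqP; split => w /=; rewrite in_itv/= lte_fin ltNge; first by move/negP.
    by move=> /negP.
  rewrite probability_setC; last first.
    by rewrite -[X in measurable X]setTI; exact: measurable_funPT.
  by rewrite EFinB -Ygumbel.
rewrite -EFinB abse_EFin lee_fin.
rewrite (_ : _ - _ - _ = - (fine (P (~` [set w | (u%:E < T_max t W (eta w))%E])) -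
  expR (- expR (- u)))); last by ring.
rewrite normrN; exact: (gumbel_bound d_gt0 mW W1 t_gt eta_poisson).
Qed.
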